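(* Assume the Lipschitz-Hessian condition, the ETO consistency conditions and the ETO regularity conditions (listed in the context), and $\|\nabla_\theta v_0(w_{\theta^{KL}})M_1^{ETO}\|\ne0$. Then there is a quantity $G^{ETO}_{n,q}$, independent of $t$, with $$G^{ETO}_{n,q}\lesssim\frac{\|M_1^{ETO}\|^2L_2}{\|\nabla_\theta v_0(w_{\theta^{KL}})M_1^{ETO}\|}\,q\,n^{-1/2}\log n+C^{ETO}_{n,q},$$ where $\lesssim$ hides a constant independent of $n$ and $q$, such that for all $t\in\mathbb R$, $$\big|\mathbb P\big(\sqrt n(v_0(\hat w^{ETO})-v_0(w_{\theta^{KL}}))\ge t\big)-\mathbb P\big(\nabla_\theta v_0(w_{\theta^{KL}})\mathbb N_1^{ETO}\ge t\big)\big|\le G^{ETO}_{n,q}.$$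
   Context: Setup. $\Omega\subset\mathbb R^p$ and $\Theta\subset\mathbb R^q$ are open, $\mathcal Z\subset\mathbb R^d$, $c:\Omega\times\mathcal Z\to\mathbb R$ is a known cost function, $P$ is the (unknown) true distribution of a random vector $z\in\mathcal Z$, and $\{P_\theta:\theta\in\Theta\}$ is a parametric family of distributions on $\mathcal Z$ with densities $p_\theta$; $P$ need not belong to the family. $v_0(w):=\mathbb E_P[c(w,z)]$. For $\theta\in\Theta$, $w_\theta\in\arg\min_{w\in\Omega}\mathbb E_{P_\theta}[c(w,z)]$. The data $z_1,\dots,z_n$ are i.i.d. from $P$. $\hat\theta^{ETO}$ maximizes $\frac1n\sum_{i=1}^n\log p_\theta(z_i)$ over $\Theta$, $\hat w^{ETO}:=w_{\hat\theta^{ETO}}$, $\theta^{KL}:=\arg\max_{\theta\in\Theta}\mathbb E_P[\log p_\theta(z)]$; all optimizers are assumed to exist. Notation. Gradients are row vectors. $\nabla_\theta v_0(w_{\theta'})$, $\nabla_{\theta\theta}v_0(w_{\theta'})$ are the gradient and Hessian of $\theta\mapsto v_0(w_\theta)$ at $\theta'$. $\|\cdot\|$ is the Euclidean/spectral norm; for a random vector $X$, $\|X\|_r:=(\mathbb E\|X\|^r)^{1/r}$. $A\le B$ for symmetric matrices means $B-A$ is positive semidefinite; $(\cdot)^{1/2}$ is the positive semidefinite square root. $Y_0\sim N(0,I_q)$, $M_1^{ETO}:=\big((\nabla_{\theta\theta}\mathbb E_P[\log p_{\theta^{KL}}(z)])^{-1}\mathrm{var}_P(\nabla_\theta\log p_{\theta^{KL}}(z))(\nabla_{\theta\theta}\mathbb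 E_P[\log p_{\theta^{KL}}(z)])^{-1}\big)^{1/2}$ ($\mathrm{var}_P$ = covariance under $P$), $\mathbb N_1^{ETO}\overset d=M_1^{ETO}Y_0$. Lipschitz-Hessian condition: $\Theta$ is bounded and $\|\nabla_{\theta\theta}v_0(w_{\theta_1})-\nabla_{\theta\theta}v_0(w_{\theta_2})\|\le L_1\|\theta_1-\theta_2\|$ for all $\theta_1,\theta_2\in\Theta$. Then $L_2:=\sup_{\theta\in\Theta}\|\nabla_{\theta\theta}v_0(w_\theta)\|<\infty$. ETO consistency conditions: $\sup_{\theta\in\Theta}|\frac1n\sum_i\log p_\theta(z_i)-\mathbb E_P[\log p_\theta(z)]|\xrightarrow{P}0$; for all $\varepsilon>0$, $\sup_{\theta\in\Theta:\|\theta-\theta^{KL}\|\ge\varepsilon}\mathbb E_P[\log p_\theta(z)]<\mathbb E_P[\log p_{\theta^{KL}}(z)]$. ETO regularity conditions: with $m(\theta,z)=-\log p_\theta(z)$ and $\bar\theta=\theta^{KL}$, $m(\cdot,z)$ is twice differentiable in $\theta$, and there are constants $\mu,c_1,c_2,c_4,\lambda_1,\lambda_2>0$, $c_3\ge0$ and nonnegative functions $K_1,K_2,K_3$ on $\mathcal Z$ with $\|K_1(z)\|_9\le c_1$, $\|K_2(z)\|_4\le c_2$, $\|K_3(z)\|_4\le c_3$ such that for all $\theta\in\Theta$, $z\in\mathcal Z$: $\mathbb E_P[m(\theta,z)]-\mathbb E_P[m(\bar\theta,z)]\ge\mu\|\theta-\bar\theta\|^2$; $|m(\theta,z)-m(\bar\theta,z)|\le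 K_1(z)\|\theta-\bar\theta\|$; $\|\nabla_{\theta\theta}m(\theta,z)-\nabla_{\theta\theta}m(\bar\theta,z)\|\le K_2(z)\|\theta-\bar\theta\|$; $\nabla_{\theta\theta}m(\bar\theta,z)\le K_3(z)I$; $\lambda_{\min}(\mathbb E_P[\nabla_\theta m(\bar\theta,z)^\top\nabla_\theta m(\bar\theta,z)])\ge\lambda_1$; $\lambda_{\min}(\nabla_{\theta\theta}\mathbb E_P[m(\bar\theta,z)])\ge\lambda_2$; $\|\nabla_\theta m(\bar\theta,z)\|_4\le c_4\sqrt q$. Berry–Esseen error term: $C^{ETO}_{n,q}:=C^{ETO}q^{9/4}n^{-1/2}$, where $C^{ETO}$ is a constant depending only on $c_1,\dots,c_4,\mu,\lambda_1,\lambda_2$ such that $|\mathbb P(\sqrt n(\hat\theta^{ETO}-\theta^{KL})\in A)-\mathbb P(M_1^{ETO}Y_0\in A)|\le C^{ETO}_{n,q}$ for all $n$ and all convex $A\subset\mathbb R^q$. *)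

(* Defs.v *)
From HB Require Import structures.
From mathcomp Require Import all_boot all_order all_algebra.
From mathcomp Require Import all_classical all_reals all_analysis.

Set Implicit Arguments.
Unset Strict Implicit.
Unset Printing Implicit Defensive.

Import Order.TTheory GRing.Theory Num.Theory.
Import numFieldNormedType.Exports.

Local Open Scope classical_set_scope.
Local Open Scope ring_scope.

Section linear_algebra.
Context {R : realType}.

(* The library norm on matrices is the sup norm; the Euclidean and spectral
   norms are therefore defined here. *)
Definition enorm n (x : 'cV[R]_n) : R := Num.sqrt (\sum_i x i 0 ^+ 2).

Definition opnorm m n (A : 'M[R]_(m, n)) : R :=
  sup [set enorm (A *m x) | x in [set x : 'cV[R]_n | enorm x <= 1]].

Definition psd n (A : 'M[R]_n) : Prop :=
  A^T = A /\ forall x : 'cV[R]_n, 0 <= (x^T *m A *m x) 0 0.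

Definition loewner_le n (A B : 'M[R]_n) : Prop := psd (B - A).

(* [S] is the positive semidefinite square root of [A]; it is unique. *)
Definition psd_sqrt n (A S : 'M[R]_n) : Prop := psd S /\ S *m S = A.

(* The smallest eigenvalue is only meaningful for symmetric matrices: the set
   of real eigenvalues may otherwise be empty, and [inf set0 = 0]. *)
Definition lambda_min n (A : 'M[R]_n) : R := inf [set a | eigenvalue A a].
Definition lambda_min_ge n (A : 'M[R]_n) (l : R) : Prop :=
  A^T = A /\ l <= lambda_min A.

End linear_algebra.

Section calculus.
Context {R : realType} {q : nat}.
Implicit Types f : 'cV[R]_q -> R.

Definition grad f (x : 'cV[R]_q) : 'rV[R]_q :=
  \row_i 'D_(delta_mx i 0) f x.

Definition hess f (x : 'cV[R]_q) : 'M[R]_q :=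
  \matrix_(i, j) 'D_(delta_mx i 0) (fun y => 'D_(delta_mx j 0) f y) x.

Definition twice_differentiable f (x : 'cV[R]_q) : Prop :=
  (\forall y \near x, differentiable f y) /\ differentiable (grad f) x.

End calculus.

(* R^n, as column vectors, with its Borel sigma-algebra. *)
Definition borel_cV (R : realType) (n : nat) :=
  g_sigma_algebraType (@open 'cV[R]_n).

Section probability.
Context {R : realType}.

Definition mutually_independent (I : choiceType)
    d (Om : measurableType d) (Pr : probability Om R)
    d' (T : measurableType d') (X : I -> Om -> T) : Prop :=
  forall (s : seq I) (B : I -> set T), uniq s ->
    (forall i, measurable (B i)) ->
    fine (Pr (\bigcap_(i in [set` s]) X i @^-1` B i)) =
      \prod_(i <- s) fine (Pr (X i @^-1` B i)).

Definition random_vector n d (Om : measurableType d)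
    (X : Om -> 'cV[R]_n) : Prop :=
  measurable_fun setT (X : Om -> borel_cV R n).

(* Y ~ N(0, I_q) *)
Definition std_gaussian q d (Om : measurableType d) (Pr : probability Om R)
    (Y : Om -> 'cV[R]_q) : Prop :=
  [/\ random_vector Y,
      forall (i : 'I_q) (A : set (measurableTypeR R)), measurable A ->
        Pr ((fun om => Y om i 0) @^-1` A) = normal_prob 0 1 A &
      mutually_independent Pr
        (fun (i : 'I_q) om => Y om i 0 : measurableTypeR R)].

Definition equal_in_law n d1 (Om1 : measurableType d1)
    (Pr1 : probability Om1 R) d2 (Om2 : measurableType d2)
    (Pr2 : probability Om2 R)
    (X1 : Om1 -> 'cV[R]_n) (X2 : Om2 -> 'cV[R]_n) : Prop :=
  forall A : set (borel_cV R n), measurable A ->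
    Pr1 (X1 @^-1` A) = Pr2 (X2 @^-1` A).

(* Functions of z are only meaningful on the outcome space [Z], of full
   P-measure, hence the restrictions. *)
Definition EP n (P : probability (borel_cV R n) R) (Z : set 'cV[R]_n)
    (f : 'cV[R]_n -> R) : R :=
  fine ('E_P[f \_ Z])%E.

Definition LrP n (P : probability (borel_cV R n) R) (Z : set 'cV[R]_n)
    (r : R) (f : 'cV[R]_n -> R) : \bar R :=
  ('N[P]_(r%:E)[EFin \o (f \_ Z)])%E.

Definition varP n (P : probability (borel_cV R n) R) (Z : set 'cV[R]_n)
    q (g : 'cV[R]_n -> 'rV[R]_q) : 'M[R]_q :=
  \matrix_(i, j)
    fine (covariance P ((fun z => g z 0 i) \_ Z) ((fun z => g z 0 j) \_ Z)).

End probability.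

(* Population-level data of the stochastic program and of the parametric model;
   [trueP] is P, [modelP th] is P_th, [dens th] is p_th, [wopt th] is w_th, and
   [dom] is the measure with respect to which the densities are taken (for
   instance the Lebesgue measure). *)
Record eto_problem (R : realType) (p q d : nat) := EtoProblem {
  Omega : set 'cV[R]_p ;
  Theta : set 'cV[R]_q ;
  Zset : set 'cV[R]_d ;
  cost : 'cV[R]_p -> 'cV[R]_d -> R ;
  trueP : probability (borel_cV R d) R ;
  modelP : 'cV[R]_q -> probability (borel_cV R d) R ;
  dom : {measure set (borel_cV R d) -> \bar R} ;
  dens : 'cV[R]_q -> 'cV[R]_d -> R ;
  wopt : 'cV[R]_q -> 'cV[R]_p ;
  thKL : 'cV[R]_q
}.

Section eto.
Context {R : realType} {p q d : nat} (S : eto_problem R p q d).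

Let Z : set (borel_cV R d) := Zset S.
Let E := EP (trueP S) (Zset S).

Definition v0 (w : 'cV[R]_p) : R := E (cost S w).

(* theta |-> v_0(w_theta) *)
Definition v0w (th : 'cV[R]_q) : R := v0 (wopt S th).

Definition loglik (th : 'cV[R]_q) (z : 'cV[R]_d) : R := ln (dens S th z).

Definition Eloglik (th : 'cV[R]_q) : R := E (loglik th).

(* [ln] is total, with [ln x = 0] for [x <= 0]: positivity of the densities
   on Z is what makes [loglik] the actual (real-valued) log-likelihood. *)
Definition setup : Prop :=
  [/\ [/\ open (Omega S), open (Theta S), measurable Z & trueP S Z = 1%E],
      [/\ sigma_finite setT (dom S),
          forall th, Theta S th -> modelP S th Z = 1%E,
          forall th, Theta S th ->
            measurable_fun Z (dens S th : borel_cV R d -> R),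
          forall th z, Theta S th -> Zset S z -> 0 < dens S th z &
          forall th (A : set (borel_cV R d)), Theta S th -> measurable A ->
            modelP S th A = (\int[dom S]_(z in A `&` Z) (dens S th z)%:E)%E],
      (forall w, Omega S w ->
         (trueP S).-integrable Z (EFin \o cost S w) /\
         forall th, Theta S th ->
           (modelP S th).-integrable Z (EFin \o cost S w)),
      (forall th, Theta S th -> Omega S (wopt S th) /\
         forall w, Omega S w ->
           EP (modelP S th) (Zset S) (cost S (wopt S th)) <=
           EP (modelP S th) (Zset S) (cost S w)) &
      [/\ forall th, Theta S th -> (trueP S).-integrable Z (EFin \o loglik th),
          Theta S (thKL S) &
          forall th, Theta S th -> Eloglik th <= Eloglik (thKL S)]].

Definition lipschitz_hessian (L1 : R) : Prop :=
  [/\ bounded_set (Theta S),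
      forall th, Theta S th -> twice_differentiable v0w th &
      forall th1 th2, Theta S th1 -> Theta S th2 ->
        opnorm (hess v0w th1 - hess v0w th2) <= L1 * enorm (th1 - th2)].

Definition L2 : R := sup [set opnorm (hess v0w th) | th in Theta S].

Definition mloss (th : 'cV[R]_q) (z : 'cV[R]_d) : R := - loglik th z.

Definition Emloss (th : 'cV[R]_q) : R := E (mloss th).

Definition eto_regularity
    (mu c1 c2 c3 c4 lam1 lam2 : R) (K1 K2 K3 : 'cV[R]_d -> R) : Prop :=
  let thb := thKL S in
  let gradm z := grad (mloss^~ z) thb in
  let hessm th z := hess (mloss^~ z) th in
  [/\ [/\ forall th z, Theta S th -> Zset S z ->
            twice_differentiable (mloss^~ z) th &
          twice_differentiable Emloss thb],
      [/\ forall z, Zset S z -> [/\ 0 <= K1 z, 0 <= K2 z & 0 <= K3 z],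
          [/\ measurable_fun Z (K1 : borel_cV R d -> R),
              measurable_fun Z (K2 : borel_cV R d -> R) &
              measurable_fun Z (K3 : borel_cV R d -> R)] &
          [/\ (LrP (trueP S) (Zset S) 9 K1 <= c1%:E)%E,
              (LrP (trueP S) (Zset S) 4 K2 <= c2%:E)%E &
              (LrP (trueP S) (Zset S) 4 K3 <= c3%:E)%E]],
      [/\ forall th, Theta S th ->
            mu * enorm (th - thb) ^+ 2 <= Emloss th - Emloss thb,
          forall th z, Theta S th -> Zset S z ->
            `|mloss th z - mloss thb z| <= K1 z * enorm (th - thb),
          forall th z, Theta S th -> Zset S z ->
            opnorm (hessm th z - hessm thb z) <= K2 z * enorm (th - thb) &
          forall z, Zset S z -> loewner_le (hessm thb z) (K3 z)%:M],
      lambda_min_ge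
        (\matrix_(i, j) E (fun z => ((gradm z)^T *m gradm z) i j)) lam1 /\
      lambda_min_ge (hess Emloss thb) lam2 &
      (LrP (trueP S) (Zset S) 4 (fun z => enorm (gradm z)^T)
         <= (c4 * Num.sqrt q%:R)%:E)%E].

Definition asymptotic_cov : 'M[R]_q :=
  let H := hess Eloglik (thKL S) in
  invmx H *m varP (trueP S) (Zset S) (fun z => grad (loglik^~ z) (thKL S))
    *m invmx H.

Section sample.
Context {dO : measure_display} {Om : measurableType dO}
  (Pr : probability Om R) (z : nat -> Om -> 'cV[R]_d).

Definition iid_sample : Prop :=
  [/\ forall i, random_vector (z i),
      forall i om, Zset S (z i om),
      forall i (A : set (borel_cV R d)), measurable A ->
        Pr (z i @^-1` A) = trueP S A &
      mutually_independent Pr (z : nat -> Om -> borel_cV R d)].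

(* The sample z_1, ..., z_n is z 0, ..., z n.-1. *)
Definition emp_loglik (n : nat) (om : Om) (th : 'cV[R]_q) : R :=
  n%:R^-1 * \sum_(i < n) loglik th (z i om).

Definition eto_estimator (thhat : nat -> Om -> 'cV[R]_q) : Prop :=
  forall n, (0 < n)%N -> random_vector (thhat n) /\
    forall om, Theta S (thhat n om) /\
      forall th, Theta S th ->
        emp_loglik n om th <= emp_loglik n om (thhat n om).

(* A supremum over Theta need not be measurable: convergence in probability
   is meant in outer probability, the two coinciding on measurable events. *)
Definition eto_consistency : Prop :=
  (forall eps : R, 0 < eps ->
     (fun n => mu_ext Pr [set om |
        (eps%:E < ereal_sup [set `|emp_loglik n om th - Eloglik th|%:E
                            | th in Theta S])%E]) @ \oo --> 0%E) /\
  (forall eps : R, 0 < eps ->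
     (ereal_sup [set (Eloglik th)%:E
                | th in [set th | Theta S th /\ (eps <= enorm (th - thKL S))%R]]
        < (Eloglik (thKL S))%:E)%E).

End sample.

End eto.

Section distances.
Context {R : realType} {q : nat}.

(* C_{n,q} = C q^{9/4} n^{-1/2} *)
Definition be_term (C : R) (n : nat) : R :=
  C * q%:R `^ (9%:R / 4%:R) / Num.sqrt n%:R.

(* The quantification is over Borel convex sets, as a convex set need not be
   Borel. *)
Definition berry_esseen (C : R)
    d1 (Om1 : measurableType d1) (Pr1 : probability Om1 R)
    (X : nat -> Om1 -> 'cV[R]_q)
    d2 (Om2 : measurableType d2) (Pr2 : probability Om2 R)
    (N : Om2 -> 'cV[R]_q) : Prop :=
  forall (n : nat) (A : set (borel_cV R q)), (0 < n)%N ->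
    measurable A -> convex_set (A : set (convex_lmodType 'cV[R]_q)) ->
    `|fine (Pr1 (X n @^-1` A)) - fine (Pr2 (N @^-1` A))| <= be_term C n.

End distances.
Arguments be_term {R} q C n.

(* Main.v *)
Require Import Defs.
From HB Require Import structures.
From mathcomp Require Import all_boot all_order all_algebra.
From mathcomp Require Import all_classical all_reals all_analysis.
From mathcomp Require Import measurable_realfun ring lra.

Set Implicit Arguments.
Unset Strict Implicit.
Unset Printing Implicit Defensive.

Import Order.TTheory GRing.Theory Num.Theory.
Import numFieldNormedType.Exports.

Local Open Scope classical_set_scope.
Local Open Scope ring_scope.

(** The hidden constant has to serve all problems and all dimensions, so where the expansion has no
    room the bound must hold trivially; the exponents allow exactly this. From |M1|^2 <= b q^2 and s
    >= r sqrt n follows q^3 ln n >= const n; ln n <= 3 n^{1/3} leaves q^3 >= const n^{2/3}, and the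
    power 3/4 turns this into q^{9/4} >= const n^{1/2}. In |M1|^2 = O(q^2), one factor q is the
    squared moment bound c4 sqrt q on the entries of the score covariance, the other is the price of
    passing from entries to the quadratic form. The level sqrt (ln n) is the one at which the
    Gaussian tail is of order n^{-1/2}: the union bound over the coordinates then disappears in the
    Berry-Esseen term, and the logarithm in the first term is the cost. Testing with a Gaussian
    kernel keeps the family of test functions stable under integrating out a coordinate, so that W
    never has to be identified as a normal variable. Unboundedness of W serves the sign of [CETO],
    which is not assumed positive although the absorption of the tail divides by it. *)

(* Taylor's formula at thKL gives
   sqrt n (v0(w_thhat) - v0(w_thKL)) = g D + O(L2 |D|^2 / sqrt n) with
   D = sqrt n (thhat - thKL) and g the gradient, so on |D| <= s the two differ by
   at most de = L2 s^2 / sqrt n.  The Berry-Esseen hypothesis on half-spaces and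
   on the ball of radius s = |M1| sqrt (q ln n) replaces D by M1 Y0; a coordinate
   of Y0 exceeds sqrt (ln n) with probability at most 2 / sqrt n, and g M1 Y0
   falls into an interval of length de with probability at most 2 de / |g M1|.
   The latter follows from the exact value of E exp (- (W - t)^2 / 2v) for a
   Gaussian linear combination W, computed one coordinate at a time; the same
   formula shows that W is unbounded.
   When s / sqrt n exceeds the radius r of the ball contained in Theta, the
   moment and growth conditions give |M1| = O(q), hence q^{9/4} n^{-1/2} is
   bounded below and the Berry-Esseen term alone exceeds 1. *)

(** * Euclidean and operator norms *)

Section euclidean_norm.
Context {R : realType}.

Lemma enorm_ge0 n (x : 'cV[R]_n) : 0 <= enorm x.
Proof. exact: sqrtr_ge0. Qed.

Lemma sqr_enorm n (x : 'cV[R]_n) : enorm x ^+ 2 = \sum_i x i 0 ^+ 2.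
Proof. by rewrite sqr_sqrtr// sumr_ge0// => i _; exact: sqr_ge0. Qed.

Lemma dot_sqr_enorm n (x : 'cV[R]_n) : (x^T *m x) 0 0 = enorm x ^+ 2.
Proof. by rewrite sqr_enorm !mxE; apply: eq_bigr => i _; rewrite !mxE expr2. Qed.

Lemma enorm0 n : enorm (0 : 'cV[R]_n) = 0.
Proof.
by apply/eqP; rewrite -sqrf_eq0 sqr_enorm big1// => i _; rewrite mxE expr0n.
Qed.

Lemma enormZ n (a : R) (x : 'cV[R]_n) : enorm (a *: x) = `|a| * enorm x.
Proof.
apply/eqP; rewrite -(@eqrXn2 _ 2) ?mulr_ge0 ?enorm_ge0 ?normr_ge0//.
rewrite exprMn !sqr_enorm real_normK ?num_real// mulr_sumr.
by apply/eqP/eq_bigr => i _; rewrite mxE exprMn.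
Qed.

Lemma enormN n (x : 'cV[R]_n) : enorm (- x) = enorm x.
Proof. by rewrite -scaleN1r enormZ normrN1 mul1r. Qed.

Lemma enorm_eq0 n (x : 'cV[R]_n) : enorm x = 0 -> x = 0.
Proof.
move=> /eqP; rewrite -sqrf_eq0 sqr_enorm psumr_eq0; last first.
  by move=> i _; exact: sqr_ge0.
move=> /allP x0; apply/matrixP => i j; rewrite ord1 mxE.
by apply/eqP; rewrite -sqrf_eq0; exact: implyP (x0 i (mem_index_enum i)) isT.
Qed.

Lemma cauchy_schwarz_mx n (x y : 'cV[R]_n) :
  `|(x^T *m y) 0 0| <= enorm x * enorm y.
Proof.
have [x0|x0] := eqVneq (enorm x) 0.
  by rewrite (enorm_eq0 x0) trmx0 mul0mx mxE normr0 enorm0 mul0r.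
have [y0|y0] := eqVneq (enorm y) 0.
  by rewrite (enorm_eq0 y0) mulmx0 mxE normr0 enorm0 mulr0.
set a := enorm x in x0 *; set b := enorm y in y0 *.
have a0 : 0 < a by rewrite lt_neqAle eq_sym x0 enorm_ge0.
have b0 : 0 < b by rewrite lt_neqAle eq_sym y0 enorm_ge0.
rewrite mxE; apply: le_trans (ler_norm_sum _ _ _) _.
(* AM-GM with weights b / a and a / b, balanced so that each of the two weighted sums equals a b. *)
pose u i := (b / a * x i 0 ^+ 2 + a / b * y i 0 ^+ 2) / 2.
apply: (@le_trans _ _ (\sum_i u i)).
  apply: ler_sum => i _; rewrite mxE /u normrM.
  rewrite -[x i 0 ^+ 2]real_normK ?num_real// -[y i 0 ^+ 2]real_normK ?num_real//.
  set s := `|x i 0|; set t := `|y i 0|.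
  have -> : (b / a * s ^+ 2 + a / b * t ^+ 2) / 2 =
    s * t + (b * s - a * t) ^+ 2 / (2 * a * b) by field; rewrite x0 y0.
  by rewrite lerDl divr_ge0 ?sqr_ge0// !mulr_ge0// ltW.
rewrite /u -mulr_suml big_split/= -!mulr_sumr -!sqr_enorm -/a -/b.
by rewrite le_eqVlt; apply/orP; left; apply/eqP; field; rewrite x0 y0.
Qed.

Lemma enormD n (x y : 'cV[R]_n) : enorm (x + y) <= enorm x + enorm y.
Proof.
rewrite -(@ler_pXn2r _ 2) ?nnegrE ?addr_ge0 ?enorm_ge0//.
have addE (A B : 'M[R]_1) : (A + B) 0 0 = A 0 0 + B 0 0 by rewrite mxE.
have dotC : (y^T *m x) 0 0 = (x^T *m y) 0 0.
  by rewrite !mxE; apply: eq_bigr => i _; rewrite !mxE mulrC.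
rewrite -dot_sqr_enorm sqrrD -!dot_sqr_enorm [(x + y)^T]linearD/= mulmxDl.
rewrite !mulmxDr !addE dotC.
by have := cauchy_schwarz_mx x y; rewrite ler_norml => /andP[_]; lra.
Qed.

Lemma enorm_le_coord n (x : 'cV[R]_n) (c : R) : 0 <= c ->
  (forall i, `|x i 0| <= c) -> enorm x <= Num.sqrt n%:R * c.
Proof.
move=> c0 xc; rewrite -(@ler_pXn2r _ 2) ?nnegrE ?enorm_ge0 ?mulr_ge0 ?sqrtr_ge0//.
rewrite sqr_enorm exprMn sqr_sqrtr// mulr_natl -[X in _ *+ X]card_ord -sumr_const.
by apply: ler_sum => i _; rewrite -[x i 0 ^+ 2]real_normK ?num_real// lerXn2r ?nnegrE.
Qed.

Lemma sum_coord_le n (x : 'cV[R]_n) :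
  \sum_i `|x i 0| <= Num.sqrt n%:R * enorm x.
Proof.
pose u : 'cV[R]_n := \col_i 1; pose v : 'cV[R]_n := \col_i `|x i 0|.
have -> : Num.sqrt n%:R = enorm u.
  by rewrite /enorm; under eq_bigr do rewrite mxE expr1n; rewrite sumr_const card_ord.
have -> : enorm x = enorm v.
  by congr Num.sqrt; apply: eq_bigr => i _; rewrite mxE real_normK ?num_real.
apply: le_trans (cauchy_schwarz_mx u v); apply: le_trans (ler_norm _).
by rewrite mxE; apply: ler_sum => i _; rewrite !mxE mul1r.
Qed.

(** The form is at most c times the squared sum of the |x_i|, and Cauchy-Schwarz against the
    all-ones vector costs the factor n. *)
Lemma form_le n (V : 'M[R]_n) (c : R) (x : 'cV[R]_n) :
  (forall i j, `|V i j| <= c) -> (x^T *m V *m x) 0 0 <= c * n%:R * enorm x ^+ 2.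
Proof.
(* Only an actual entry of [V] yields 0 <= c, hence the separate case n = 0. *)
case: n V x => [|n] V x Vc; first by rewrite mxE big_ord0 mulr0 mul0r.
have c0 : 0 <= c by apply: le_trans (Vc 0 0).
apply: (@le_trans _ _ (c * (\sum_i `|x i 0|) ^+ 2)); last first.
  rewrite -mulrA ler_wpM2l// -[n.+1%:R]sqr_sqrtr ?ler0n// -exprMn.
  rewrite lerXn2r ?nnegrE ?mulr_ge0 ?sqrtr_ge0 ?enorm_ge0 ?sum_coord_le//.
  by rewrite sumr_ge0.
rewrite mxE expr2 mulrA mulr_sumr; apply: ler_sum => j _.
rewrite (le_trans (ler_norm _))// normrM ler_wpM2r// mxE.
rewrite (le_trans (ler_norm_sum _ _ _))// mulr_sumr; apply: ler_sum => i _.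
by rewrite mxE normrM mulrC ler_wpM2r.
Qed.

(** A crude constant suffices: it only shows that the supremum defining [opnorm] runs over a bounded
    set. *)
Lemma mulmx_bounded m n (A : 'M[R]_(m, n)) :
  exists2 c : R, 0 <= c & forall x, enorm (A *m x) <= c * enorm x.
Proof.
exists (Num.sqrt m%:R * \sum_i enorm (row i A)^T).
  by rewrite mulr_ge0 ?sqrtr_ge0// sumr_ge0// => i _; exact: enorm_ge0.
move=> x; rewrite -mulrA; apply: enorm_le_coord => [|i].
  by rewrite mulr_ge0 ?enorm_ge0// sumr_ge0// => i _; exact: enorm_ge0.
apply: (@le_trans _ _ (enorm (row i A)^T * enorm x)).
  apply: le_trans (cauchy_schwarz_mx _ _).
  by rewrite trmxK -row_mul !mxE.
rewrite ler_wpM2r ?enorm_ge0// (bigD1 i)//= lerDl.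
by rewrite sumr_ge0// => j _; exact: enorm_ge0.
Qed.

Lemma has_sup_opnorm m n (A : 'M[R]_(m, n)) :
  has_sup [set enorm (A *m x) | x in [set x : 'cV[R]_n | enorm x <= 1]].
Proof.
split; first by exists (enorm (A *m 0)), 0 => //=; rewrite enorm0.
have [c c0 Ac] := mulmx_bounded A.
exists c => _ [x /= x1 <-]; apply: le_trans (Ac x) _.
by rewrite ler_piMr.
Qed.

Lemma opnorm_ge0 m n (A : 'M[R]_(m, n)) : 0 <= opnorm A.
Proof.
rewrite -(enorm0 m) -(mulmx0 1 A); apply: (sup_upper_bound (has_sup_opnorm A)).
by exists 0 => //=; rewrite enorm0.
Qed.

Lemma enorm_mulmx m n (A : 'M[R]_(m, n)) x : enorm (A *m x) <= opnorm A * enorm x.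
Proof.
have [x0|x0] := eqVneq (enorm x) 0.
  by rewrite (enorm_eq0 x0) mulmx0 !enorm0 mulr0.
have xp : 0 < enorm x by rewrite lt_neqAle eq_sym x0 enorm_ge0.
rewrite -ler_pdivrMr//; have <- : enorm (A *m ((enorm x)^-1 *: x)) = enorm (A *m x) / enorm x.
  by rewrite -scalemxAr enormZ mulrC gtr0_norm ?invr_gt0.
apply: (sup_upper_bound (has_sup_opnorm A)); exists ((enorm x)^-1 *: x) => //=.
by rewrite enormZ gtr0_norm ?invr_gt0// mulVf.
Qed.

Lemma opnorm_le m n (A : 'M[R]_(m, n)) (c : R) : 0 <= c ->
  (forall x, enorm (A *m x) <= c * enorm x) -> opnorm A <= c.
Proof.
move=> c0 Ac; apply: ge_sup; first by case: (has_sup_opnorm A).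
by move=> _ [x /= x1 <-]; rewrite (le_trans (Ac x))// ler_piMr.
Qed.

Lemma opnormD m n (A B : 'M[R]_(m, n)) : opnorm (A + B) <= opnorm A + opnorm B.
Proof.
apply: opnorm_le => [|x]; first by rewrite addr_ge0 ?opnorm_ge0.
by rewrite mulmxDl mulrDl (le_trans (enormD _ _))// lerD// enorm_mulmx.
Qed.

(** By Cauchy-Schwarz, coercivity gives mu |x| <= |H x|, which yields both injectivity and the bound
    on the inverse; symmetry of [H] does not enter. *)
Lemma coercive_unitmx n (H : 'M[R]_n) (mu : R) : 0 < mu ->
  (forall x, mu * enorm x ^+ 2 <= (x^T *m H *m x) 0 0) ->
  H \in unitmx /\ forall x, enorm (invmx H *m x) <= mu^-1 * enorm x.
Proof.
move=> mu0 Hmu.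
have lb x : mu * enorm x <= enorm (H *m x).
  have [->|x0] := eqVneq (enorm x) 0; first by rewrite mulr0 enorm_ge0.
  have xp : 0 < enorm x by rewrite lt_neqAle eq_sym x0 enorm_ge0.
  rewrite -(ler_pM2l xp) mulrCA -expr2; apply: le_trans (Hmu x) _.
  by rewrite -mulmxA; apply: le_trans (ler_norm _) (cauchy_schwarz_mx _ _).
have Hu : H \in unitmx.
  (* A row of the left kernel of the transpose is the transpose of a vector that [H] kills. *)
  rewrite -unitmx_tr -row_free_unit -kermx_eq0; apply/eqP/row_matrixP => i.
  rewrite row0; apply/eqP; rewrite -trmx_eq0; apply/eqP/enorm_eq0/eqP.
  rewrite eq_le enorm_ge0 andbT -(ler_pM2l mu0) mulr0 (le_trans (lb _))//.
  have -> : H *m (row i (kermx H^T))^T = (row i (kermx H^T *m H^T))^T.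
    by rewrite row_mul trmx_mul trmxK.
  by rewrite mulmx_ker row0 trmx0 enorm0.
split=> // x; rewrite -(ler_pM2l mu0) mulVKf ?gt_eqF//.
by rewrite (le_trans (lb _))// mulKVmx.
Qed.

End euclidean_norm.

(** * Second-order differential calculus along lines *)

Lemma MVT0 (R : realType) (F dF : R -> R) (b : R) : 0 < b ->
  (forall t, 0 <= t <= b -> is_derive t 1 F (dF t)) ->
  exists2 c, 0 < c < b & F b - F 0 = dF c * b.
Proof.
move=> b0 dF1; have [||c] := @MVT R F dF 0 b b0.
- by move=> t; rewrite in_itv/= => /andP[t0 tb]; apply: dF1; rewrite !ltW.
- apply: derivable_within_continuous => t; rewrite in_itv/= => tb.
  by have [] := dF1 t tb.
- by rewrite in_itv/= subr0; exists c.
Qed.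

Section directional_derivatives.
Context {R : realType} {q : nat}.
Implicit Types (f : 'cV[R]_q -> R) (x y u w : 'cV[R]_q).

Lemma is_derive_grad f x u : differentiable f x ->
  is_derive x u f ((grad f x *m u) 0 0).
Proof.
move=> df; apply: DeriveDef; first exact: diff_derivable.
have {1}-> : u = \sum_i u i 0 *: delta_mx i 0.
  by rewrite [LHS]matrix_sum_delta; apply: eq_bigr => i _; rewrite big_ord1.
rewrite deriveE// linear_sum mxE; apply: eq_bigr => i _.
by rewrite linearZ/= mxE -deriveE// mulrC.
Qed.

Lemma is_derive_hess f x u w : twice_differentiable f x ->
  is_derive x u (fun y => (grad f y *m w) 0 0) ((u^T *m hess f x *m w) 0 0).
Proof.
move=> [_ dg].
have dj j : is_derive x u (fun y => 'D_(delta_mx j 0) f y)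
    ((u^T *m hess f x) 0 j).
  have dfj : differentiable (fun y => 'D_(delta_mx j 0) f y) x.
    have -> : (fun y => 'D_(delta_mx j 0) f y) =
        (fun M : 'rV[R]_q => M 0 j) \o grad f.
      by apply/funext => y /=; rewrite mxE.
    by apply: differentiable_comp => //; exact: differentiable_coord.
  apply: is_derive_eq; first exact: is_derive_grad dfj.
  by rewrite !mxE; apply: eq_bigr => i _; rewrite !mxE mulrC.
have -> : (fun y => (grad f y *m w) 0 0) =
    \sum_j (w j 0 \*: (fun y => 'D_(delta_mx j 0) f y)).
  apply/funext => y; rewrite fct_sumE mxE; apply: eq_bigr => j _.
  by rewrite mxE mulrC.
by apply: is_derive_eq; rewrite mxE; apply: eq_bigr => j _; rewrite mulrC.
Qed.

Lemma is_derive_line (F : 'cV[R]_q -> R) x u (t l : R) :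
  is_derive (x + t *: u) u F l -> is_derive t 1 (fun t => F (x + t *: u)) l.
Proof.
have e : (fun h : R => h^-1 *: (((fun t => F (x + t *: u)) \o shift t) (h *: 1) -
      F (x + t *: u))) =
    (fun h => h^-1 *: ((F \o shift (x + t *: u)) (h *: u) - F (x + t *: u))).
  apply/funext => h /=; congr (_ *: (F _ - _)).
  by rewrite scalerDl -[h *: 1]/(h * 1) mulr1 addrCA.
by move=> [d <-]; apply: DeriveDef; rewrite /derivable /derive e.
Qed.

(** Two nested applications of the mean value theorem along the segment replace an integral
    remainder: no continuity of the Hessian is required, and only the sharp factor 1/2 is lost. *)
Lemma taylor1_le f x u (M : R) :
  (forall t : R, 0 <= t <= 1 -> twice_differentiable f (x + t *: u)) ->
  (forall t : R, 0 <= t <= 1 -> opnorm (hess f (x + t *: u)) <= M) ->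
  `|f (x + u) - f x - (grad f x *m u) 0 0| <= M * enorm u ^+ 2.
Proof.
move=> df hM.
pose p t := f (x + t *: u); pose p1 t := (grad f (x + t *: u) *m u) 0 0.
pose p2 t := (u^T *m hess f (x + t *: u) *m u) 0 0.
have d1 (t : R) : 0 <= t <= 1 -> is_derive t 1 p (p1 t).
  move=> /df [/nbhs_singleton dt _].
  by apply: is_derive_line; exact: is_derive_grad.
have d2 (t : R) : 0 <= t <= 1 -> is_derive t 1 p1 (p2 t).
  move=> /df dt; rewrite /p1.
  apply: (@is_derive_line (fun y => (grad f y *m u) 0 0)).
  exact: is_derive_hess.
have [c /andP[c0 c1] pc] := MVT0 ltr01 d1.
have [|e /andP[e0 ec] p1c] := @MVT0 _ p1 p2 c c0.
  by move=> t /andP[t0 tc]; apply: d2; rewrite t0 (le_trans tc) ?ltW.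
have e1 : 0 <= e <= 1 by rewrite !ltW// (lt_trans ec).
have -> : f (x + u) - f x - (grad f x *m u) 0 0 = p2 e * c.
  by rewrite -p1c -[p1 c]mulr1 -pc /p /p1 !scale0r !addr0 scale1r.
rewrite normrM (gtr0_norm c0).
apply: (@le_trans _ _ `|p2 e|); first by rewrite ler_piMr// ltW.
rewrite /p2 -mulmxA (le_trans (cauchy_schwarz_mx _ _))//.
rewrite expr2 mulrCA ler_wpM2l ?enorm_ge0//.
by rewrite (le_trans (enorm_mulmx _ _))// ler_wpM2r ?enorm_ge0// hM.
Qed.

(** A derivative that does not exist takes the default value 0, its own opposite; this is why
    [gradN] and [hessN] carry no differentiability hypothesis. *)
Lemma deriveN_total f x u : 'D_u (fun y => - f y) x = - 'D_u f x.
Proof.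
have [df|ndf] := pselect (derivable f x u); first exact: deriveN.
have ndf' : ~ derivable (fun y => - f y) x u.
  move=> /derivableN; apply: contra_not ndf.
  by have -> : - (fun y => - f y) = f by apply/funext => y; rewrite opprK.
by rewrite /derive (dvgP ndf) (dvgP ndf') oppr0.
Qed.

Lemma gradN f x : grad (fun y => - f y) x = - grad f x.
Proof. by apply/matrixP => i j; rewrite !mxE deriveN_total. Qed.

Lemma hessN f x : hess (fun y => - f y) x = - hess f x.
Proof.
apply/matrixP => i j; rewrite !mxE -deriveN_total.
by congr derive; apply/funext => y; rewrite deriveN_total.
Qed.

End directional_derivatives.

Section second_order.
Context {R : realType} {q : nat}.

(** The gradient is differentiable at [x] alone. If the slope of [p1] at 0 were below mu |u|^2,
    then, as [p1] vanishes at the minimum 0, the mean value theorem would give p b - p 0 = b (p1 c)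
    < mu |u|^2 c b <= mu |u|^2 b^2 for a small b, against the growth. The sharp bound has 2 mu; the
    lost factor only affects the hidden constant. *)
Lemma quadratic_growth_hess (f : 'cV[R]_q -> R) (x u : 'cV[R]_q) (mu r : R) :
  0 < r -> twice_differentiable f x ->
  (forall y, enorm (y - x) < r -> mu * enorm (y - x) ^+ 2 <= f y - f x) ->
  0 <= mu -> mu * enorm u ^+ 2 <= (u^T *m hess f x *m u) 0 0.
Proof.
move=> r0 df growth mu0.
pose p (t : R) : R := f (x + t *: u); pose p1 (t : R) : R := (grad f (x + t *: u) *m u) 0 0.
have cl : (fun t : R => x + t *: u) @ (0 : R) --> x.
  have {2}-> : x = x + 0 *: u by rewrite scale0r addr0.
  by apply: cvgD; [exact: cvg_cst|apply: cvgZr_tmp; exact: cvg_id].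
have : \forall t \near (0 : R), differentiable f (x + t *: u).
  by case: df => + _; exact: cl.
move=> /nbhs_ballP[e1 /= e10 de1].
(* Within this radius [f] is differentiable and the growth hypothesis applies; the [+ 1] covers u =
   0. *)
pose e := Num.min e1 (r / (enorm u + 1)).
have u1 : 0 < enorm u + 1 by rewrite ltr_wpDl ?enorm_ge0.
have e0 : 0 < e by rewrite lt_min e10 divr_gt0.
have d1 (t : R) : t \in `]-e, e[%R -> is_derive t 1 p (p1 t).
  rewrite in_itv/= => te; apply: is_derive_line; apply: is_derive_grad.
  apply: de1; rewrite /ball/= sub0r normrN ltr_norml.
  by case/andP: te => t1 t2; rewrite (lt_le_trans t2) ?ge_min ?lexx// andbT
    (le_lt_trans _ t1)// lerN2 ge_min lexx.
have grow (t : R) : t \in `]-e, e[%R -> mu * t ^+ 2 * enorm u ^+ 2 <= p t - p 0.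
  rewrite in_itv/= -ltr_norml => te.
  have xtu : x + t *: u - x = t *: u by rewrite addrC addKr.
  rewrite /p scale0r addr0 -mulrA -[t ^+ 2]real_normK ?num_real// -exprMn -enormZ.
  rewrite -{2}xtu; have := growth (x + t *: u); rewrite !xtu; apply.
  rewrite enormZ; apply: (@le_lt_trans _ _ (`|t| * (enorm u + 1))).
    by rewrite ler_wpM2l// lerDl.
  by rewrite -ltr_pdivlMr// (lt_le_trans te)// ge_min lexx orbT.
have z0 : (0 : R) \in `]-e, e[%R by rewrite in_itv/= oppr_lt0 e0.
have p10 : p1 0 = 0.
  have [|t /d1[]//|t te|] := @derive1_at_min R p (- e) e 0 _ _ z0.
  - by rewrite (@le_trans _ _ 0) ?oppr_le0 ?ltW.
  - rewrite -subr_ge0; apply: le_trans (grow _ te).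
    exact: mulr_ge0 (mulr_ge0 mu0 (sqr_ge0 t)) (sqr_ge0 _).
  - by move=> _; rewrite (@derive_val _ _ _ _ _ _ _ (d1 _ z0)).
have [d2 d2E] : is_derive (0 : R) 1 p1 ((u^T *m hess f x *m u) 0 0).
  apply: (@is_derive_line _ _ (fun y => (grad f y *m u) 0 0)).
  by rewrite scale0r addr0; exact: is_derive_hess.
rewrite -d2E leNgt; apply/negP => lt_mu.
have : \forall h \near (0 : R)^',
    h^-1 *: ((p1 \o shift 0) (h *: 1) - p1 0) < mu * enorm u ^+ 2.
  by apply: (cvgr_lt _ d2).
move=> /nbhs_ballP[e2 /= e20 he2].
pose b := Num.min (e / 2) (e2 / 2).
have b0 : 0 < b by rewrite lt_min !divr_gt0.
have be : b < e by rewrite gt_min ltr_pdivrMr// ltr_pMr// ltr1n.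
have be2 : b < e2 by rewrite gt_min [e2 / 2 < _]ltr_pdivrMr// ltr_pMr// ltr1n orbT.
have inb t : 0 <= t <= b -> t \in `]-e, e[%R.
  by move=> /andP[t0 tb]; rewrite in_itv/= (lt_le_trans _ t0) ?oppr_lt0//= (le_lt_trans tb).
have [|c /andP[c0 cb] pb] := @MVT0 _ p p1 b b0.
  by move=> t /inb; exact: d1.
have := he2 c; rewrite /ball/= sub0r normrN gtr0_norm// => /(_ (lt_trans cb be2)).
rewrite gt_eqF// => /(_ isT); rewrite p10 subr0 addr0 [c *: 1]mulr1.
rewrite -[_ *: _]/(c^-1 * _) mulrC ltr_pdivrMr// => p1c.
have /inb/grow : 0 <= b <= b by rewrite ltW/=.
rewrite pb leNgt => /negP; apply.
apply: (@lt_le_trans _ _ (mu * enorm u ^+ 2 * c * b)); first by rewrite ltr_pM2r.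
have -> : mu * b ^+ 2 * enorm u ^+ 2 = mu * enorm u ^+ 2 * b * b by ring.
apply: (ler_wpM2r (ltW b0)); apply: ler_wpM2l (ltW cb).
exact: mulr_ge0 mu0 (sqr_ge0 _).
Qed.

End second_order.

(** * Independence and Gaussian linear combinations *)

Section independence.
Context {R : realType} d {Om : measurableType d} (Pr : probability Om R).
Local Open Scope ereal_scope.

Section joint_law.
Variables (f g : {RV Pr >-> measurableTypeR R}).
Let h om := (f om, g om).

Let mh : measurable_fun setT h.
Proof. exact: measurable_fun_pair. Qed.

(* Relativized to an event [E], so that it survives the induction over the
   coordinates in [independent_lincomb]. *)
Lemma joint_law (E : set Om) : measurable E ->
  (forall A C : set (measurableTypeR R), measurable A -> measurable C ->
    Pr (f @^-1` A `&` (g @^-1` C `&` E)) =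
    Pr (f @^-1` A) * (Pr (g @^-1` C) * Pr E)) ->
  forall X, measurable X ->
    Pr (h @^-1` X `&` E) = Pr E * (distribution Pr f \x distribution Pr g) X.
Proof.
move=> mE indep X mX.
have pE0 : (0 <= fine (Pr E))%R by exact: fine_ge0.
(* Putting the factor [Pr E] on the second law makes the right-hand side a product measure; the
   left-hand side is the pushforward of [Pr] restricted to [E], so agreement on rectangles is
   enough. *)
pose m2 := mscale (NngNum pE0) (distribution Pr g).
have PrE : (fine (Pr E))%:E = Pr E by rewrite fineK// fin_num_measure.
pose m' := [the {measure set _ -> \bar R} of pushforward (mrestr Pr mE) h].
transitivity ((distribution Pr f \x m2) X).
  apply/esym/(@product_measure_unique _ _ _ _ _ (distribution Pr f) m2 (m' mh)).
    move=> A C mA mC.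
    transitivity (distribution Pr f A * ((fine (Pr E))%:E * distribution Pr g C)) => //.
    rewrite PrE [X in _ = _ * X]muleC -indep// setIA.
    by congr (Pr (_ `&` _)).
  by [].
rewrite /product_measure1 /= /m2 /mscale/= PrE.
rewrite ge0_integralZl//; exact: measurable_fun_xsection.
Qed.

End joint_law.

Section lincomb.
Variables (I : choiceType) (Y : I -> {RV Pr >-> measurableTypeR R}) (a : I -> R).

Definition lincomb (l : seq I) (om : Om) : measurableTypeR R :=
  (\sum_(i <- l) a i * Y i om)%R.

Let measurable_lincomb l : measurable_fun setT (lincomb l).
Proof.
apply: measurable_sum => i; apply: measurable_funM; first exact: measurable_cst.
exact: (measurable_funP (Y i)).
Qed.

HB.instance Definition _ l :=
  isMeasurableFun.Build _ _ _ _ (lincomb l) (measurable_lincomb l).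

Hypothesis indepY : mutually_independent Pr (fun i => Y i : Om -> measurableTypeR R).

Let cap (s : seq I) (B : I -> set (measurableTypeR R)) :=
  \bigcap_(i in [set` s]) Y i @^-1` B i.

Let measurable_cap s B : (forall i, measurable (B i)) -> measurable (cap s B).
Proof.
move=> mB; apply: fin_bigcap_measurable => // i _.
by rewrite -[X in measurable X]setTI; exact: measurable_funP.
Qed.

Let cap_cons i s B : cap (i :: s) B = Y i @^-1` B i `&` cap s B.
Proof.
apply/seteqP; split=> [om capom|om [Bi capom] j].
  by split=> [|j js]; apply: capom; rewrite /= inE ?eqxx// [j \in s]js orbT.
by rewrite /= inE => /orP[/eqP ->|/capom].
Qed.

Let Pr_cap_cons i s B : uniq (i :: s) -> (forall j, measurable (B j)) ->
  Pr (cap (i :: s) B) = Pr (Y i @^-1` B i) * Pr (cap s B).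
Proof.
move=> uis mB; have us : uniq s by case/andP: uis.
have mYi : measurable (Y i @^-1` B i).
  by rewrite -[X in measurable X]setTI; exact: measurable_funP.
have := indepY uis mB; rewrite big_cons -(indepY us mB) => H.
rewrite -[LHS]fineK ?fin_num_measure//; last exact: measurable_cap.
by rewrite H EFinM !fineK ?fin_num_measure//; exact: measurable_cap.
Qed.

Let lincomb_cons_preimage i l A : lincomb (i :: l) @^-1` A =
  (fun om => (lincomb l om, Y i om)) @^-1`
    ((fun p : measurableTypeR R * measurableTypeR R =>
       (a i * p.2 + p.1)%R) @^-1` A).
Proof. by apply/seteqP; split=> om /=; rewrite /lincomb big_cons. Qed.

Let measurable_step i (A : set (measurableTypeR R)) : measurable A ->
  measurable ((fun p : measurableTypeR R * measurableTypeR R =>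
       (a i * p.2 + p.1)%R : measurableTypeR R) @^-1` A).
Proof.
move=> mA; rewrite -[X in measurable X]setTI.
suff : measurable_fun setT (fun p : measurableTypeR R * measurableTypeR R =>
       (a i * p.2 + p.1)%R : measurableTypeR R) by exact.
by apply: measurable_funD => //; apply: measurable_funM.
Qed.

(** Peeling [i] off the combination requires [lincomb l] to be independent of the joint event on
    [Y i] and [cap s B]; this is the induction hypothesis for the list [i :: s], which is why [s]
    and [B] stay general. *)
Lemma independent_lincomb l s A B : uniq (l ++ s) -> measurable A ->
  (forall i, measurable (B i)) ->
  Pr (lincomb l @^-1` A `&` cap s B) = Pr (lincomb l @^-1` A) * Pr (cap s B).
Proof.
elim: l s A B => [|i l IH] s A B /= uls mA mB.
  have [A0|A0] := pselect (A 0%R).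
    have -> : lincomb [::] @^-1` A = setT.
      by apply/seteqP; split=> om //= _; rewrite /lincomb big_nil.
    by rewrite setTI probability_setT mul1e.
  have -> : lincomb [::] @^-1` A = set0.
    by apply/seteqP; split=> om //=; rewrite /lincomb big_nil.
  by rewrite set0I measure0 mul0e.
(* Used for [s] and for the empty list: the product-law factor is the same in both, and the empty
   list identifies it as the probability of the combination alone. *)
have joint s' : uniq (i :: l ++ s') ->
    Pr (lincomb (i :: l) @^-1` A `&` cap s' B) = Pr (cap s' B) *
      (distribution Pr (lincomb l) \x distribution Pr (Y i))
      ((fun p : measurableTypeR R * measurableTypeR R =>
         (a i * p.2 + p.1)%R) @^-1` A).
  move=> uls'; rewrite lincomb_cons_preimage.
  apply: joint_law; [exact: measurable_cap| |exact: measurable_step].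
  (* Since [i] is not in [s'], changing [B] at [i] leaves [cap s' B] unchanged and makes the event
     on [Y i] one more member of the intersection. *)
  move=> D C mD mC; pose B' j := if j == i then C else B j.
  have mB' j : measurable (B' j) by rewrite /B'; case: ifP.
  have := uls'; rewrite cons_uniq mem_cat negb_or cat_uniq.
  move=> /andP[/andP[_ is'] /and3P[_ _ us']].
  have <- : cap s' B' = cap s' B.
    apply: eq_bigcapr => j /= js; rewrite /B'; case: eqP => // ji.
    by move: is'; rewrite -ji js.
  have BC : B' i = C by rewrite /B' eqxx.
  have uis : uniq (i :: s') by rewrite /= is'.
  rewrite -{1 2}BC -Pr_cap_cons// -cap_cons IH//.
  by rewrite -cat1s uniq_catCA.
rewrite joint// muleC; congr (_ * _).
have cap0 : cap [::] B = setT by apply/seteqP; split.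
have := joint [::]; rewrite cats0 cap0 setIT probability_setT mul1e => -> //.
by move: uls; rewrite cons_uniq mem_cat negb_or cat_uniq
  => /andP[/andP[/= -> _] /andP[->]].
Qed.

End lincomb.
End independence.

(** * Integrals against the normal law on the line *)

Section gaussian.
Context {R : realType}.
Notation mu := (@lebesgue_measure R).

Lemma measurable_normr_gt (s : R) :
  measurable ([set x | s < `|x|] : set (measurableTypeR R)).
Proof.
rewrite (_ : [set x | _] = `]s, +oo[ `|` `]-oo, - s[); first exact: measurableU.
apply/seteqP; split=> x; rewrite /= !in_itv/= andbT ltr_normr ltrNr.
  by move=> /orP.
by move=> ?; apply/orP.
Qed.

(** For x > s >= 0, x^2 >= s^2 + (x - s)^2, so the density is at most exp(- s^2 / 2) times the
    density centred at s, and symmetrically for x < - s. Integrating both shifted densities over the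
    whole line gives the factor 2. *)
Lemma normal_prob_tail (s : R) : 0 <= s ->
  (normal_prob 0 1 [set x : measurableTypeR R | (s < `|x|)%R] <=
   (2 * expR (- (s ^+ 2 / 2)))%:E)%E.
Proof.
move=> s0; set A := [set x | _]; set c := expR _.
have mA : measurable (A : set (measurableTypeR R)) by exact: measurable_normr_gt.
pose F x := c * (normal_pdf s 1 x + normal_pdf (- s) 1 x).
have mF : measurable_fun setT F.
  apply: measurable_funM => //.
  by apply: measurable_funD; exact: measurable_normal_pdf.
have F0 x : 0 <= F x by rewrite mulr_ge0 ?addr_ge0 ?normal_pdf_ge0 ?expR_ge0.
apply: (@le_trans _ _ (\int[mu]_(x in A) (F x)%:E)%E).
  apply: ge0_le_integral => //=.
  - by move=> x _; rewrite lee_fin normal_pdf_ge0.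
  - by apply/measurable_funTS/measurable_EFinP; exact: measurable_normal_pdf.
  - exact/measurable_funTS/measurable_EFinP.
  move=> x; rewrite /A/= => sx; rewrite lee_fin /F !normal_pdfE ?oner_eq0//.
  have nE m : normal_fun m 1 x = expR (- ((x - m) ^+ 2 / 2)).
    by rewrite /normal_fun expr1n mulNr.
  rewrite -mulrDr mulrCA ler_wpM2l ?normal_peak_ge0// !nE mulrDr -!expRD.
  case: (lerP 0 x) => x0.
    rewrite (ger0_norm x0) in sx.
    have : 0 <= s * (x - s) by rewrite mulr_ge0// subr_ge0 ltW.
    by move=> ?; rewrite -[leLHS]addr0 lerD ?expR_ge0// ler_expR; nra.
  rewrite (ltr0_norm x0) in sx.
  have : 0 <= s * (- x - s) by rewrite mulr_ge0// subr_ge0 ltW.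
  by move=> ?; rewrite -[leLHS]add0r lerD ?expR_ge0// ler_expR; nra.
apply: (@le_trans _ _ (\int[mu]_x (F x)%:E)%E).
  apply: ge0_subset_integral => //; first exact/measurable_EFinP.
  by move=> x _; rewrite lee_fin.
under eq_integral do rewrite EFinM EFinD.
rewrite ge0_integralZl//; last 3 first.
- by apply: emeasurable_funD; apply/measurable_EFinP; exact: measurable_normal_pdf.
- by move=> x _; rewrite adde_ge0// lee_fin normal_pdf_ge0.
- by rewrite lee_fin expR_ge0.
rewrite ge0_integralD//; last 4 first.
- by move=> x _; rewrite lee_fin normal_pdf_ge0.
- by apply/measurable_EFinP; exact: measurable_normal_pdf.
- by move=> x _; rewrite lee_fin normal_pdf_ge0.
- by apply/measurable_EFinP; exact: measurable_normal_pdf.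
by rewrite !integral_normal_pdf -EFinD -EFinM lee_fin mulrC.
Qed.

Lemma integral_normal_prob (m s : R) (f : measurableTypeR R -> \bar R) :
  measurable_fun setT f -> (\int[normal_prob m s]_x `|f x| < +oo)%E ->
  (\int[normal_prob m s]_x f x = \int[mu]_x (f x * (normal_pdf m s x)%:E))%E.
Proof.
move=> mf finf; have dom := @normal_prob_dominates R m s.
rewrite -(Radon_Nikodym_change_of_variables dom)//=; last exact/integrableP.
apply: ae_eq_integral => //.
- by apply: emeasurable_funM => //; apply: (measurable_int mu).
- apply: emeasurable_funM => //=; apply/measurable_EFinP.
  exact: measurable_normal_pdf.
- apply: ae_eqe_mul2l => /=.
  rewrite Radon_NikodymE//=; case: cid => /= h [h1 h2 h3].
  apply: integral_ae_eq => //=.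
    by apply/measurable_EFinP; exact: measurable_normal_pdf.
  by move=> E E01 mE; rewrite -h3.
Qed.

(** The density of N(0, v) without its normalizing constant: it stays in [0, 1] and is at least 1/2
    when x^2 <= v, which makes it a smooth stand-in for an indicator. *)
Definition gauss_kernel (v x : R) : R := expR (- (x ^+ 2 / (2 * v))).

Lemma gauss_kernel_ge0 v x : 0 <= gauss_kernel v x.
Proof. exact: expR_ge0. Qed.

Lemma gauss_kernel_le1 v x : 0 < v -> gauss_kernel v x <= 1.
Proof.
by move=> v0; rewrite -expR0 ler_expR oppr_le0 divr_ge0 ?sqr_ge0 ?mulr_ge0// ltW.
Qed.

Lemma measurable_gauss_kernel v (b c : R) :
  measurable_fun setT (fun y : measurableTypeR R => gauss_kernel v (b * y + c)).
Proof.
rewrite /gauss_kernel; do 2 apply: measurableT_comp => //=.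
apply: measurable_funM => //; apply: measurable_funX.
by apply: measurable_funD => //; exact: measurable_funM.
Qed.

(* Completing the square turns the integrand into a normal density. *)
Lemma integral_gauss_kernel (v b c : R) : 0 < v ->
  (\int[normal_prob 0 1]_y (gauss_kernel v (b * y + c))%:E =
   (Num.sqrt (v / (v + b ^+ 2)) * gauss_kernel (v + b ^+ 2) c)%:E)%E.
Proof.
move=> v0; have w0 : 0 < v + b ^+ 2 by rewrite ltr_wpDr ?sqr_ge0.
have mk := @measurable_gauss_kernel v b c.
rewrite integral_normal_prob; last 2 first.
- exact/measurable_EFinP.
- apply: (@le_lt_trans _ _ (\int[normal_prob 0 1]_(x in [set: measurableTypeR R]) (cst 1%E x))%E).
    apply: ge0_le_integral => //.
    - by do 2 apply: measurableT_comp => //.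
    - move=> x _ /=; rewrite lee_fin ger0_norm ?gauss_kernel_ge0//.
      exact: gauss_kernel_le1.
  by rewrite integral_cst//= probability_setT mul1e ltry.
(* Standard deviation and mean of the normal density that remains after completing the square. *)
set C := Num.sqrt _; pose m := - (b * c) / (v + b ^+ 2).
have C0 : 0 < C by rewrite sqrtr_gt0 divr_gt0.
have C2 : C ^+ 2 = v / (v + b ^+ 2) by rewrite sqr_sqrtr// divr_ge0// ltW.
transitivity (\int[mu]_x ((C * gauss_kernel (v + b ^+ 2) c)%:E *
    (normal_pdf m C x)%:E))%E.
  apply: eq_integral => x _; rewrite -!EFinM; congr (_%:E).
  rewrite !normal_pdfE ?oner_eq0 ?gt_eqF//.
  have -> : normal_peak C = C^-1 * normal_peak 1.
    rewrite /normal_peak expr1n mul1r -mulrnAr sqrtrM ?sqr_ge0//.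
    by rewrite sqrtr_sqr gtr0_norm// invfM.
  rewrite [RHS](_ : _ = normal_peak 1 *
    (gauss_kernel (v + b ^+ 2) c * normal_fun m C x)); last first.
    by field; rewrite gt_eqF.
  rewrite mulrCA; congr (_ * _).
  rewrite /gauss_kernel /normal_fun -!expRD; congr expR.
  rewrite C2 /m expr1n mulr2n; field.
  by rewrite !gt_eqF.
rewrite ge0_integralZl//; last 3 first.
- by apply/measurable_EFinP; exact: measurable_normal_pdf.
- by move=> x _; rewrite lee_fin normal_pdf_ge0.
- by rewrite lee_fin mulr_ge0 ?gauss_kernel_ge0 ?ltW.
by rewrite integral_normal_pdf mule1.
Qed.

End gaussian.

Section gaussian_lincomb.
Context {R : realType} d {Om : measurableType d} (Pr : probability Om R).
Variables (I : choiceType) (Y : I -> {RV Pr >-> measurableTypeR R}).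
Hypothesis normalY : forall i (A : set (measurableTypeR R)), measurable A ->
  Pr (Y i @^-1` A) = normal_prob 0 1 A.
Hypothesis indepY : mutually_independent Pr (fun i => Y i : Om -> measurableTypeR R).

(* Integrating out one coordinate at a time, the variance of the coordinate
   moves from the random variable into the kernel. *)
Lemma expectation_gauss_kernel (a : I -> R) (l : seq I) (v t : R) :
  uniq l -> 0 < v ->
  let s2 := \sum_(i <- l) a i ^+ 2 in
  (\int[Pr]_om (gauss_kernel v (lincomb Y a l om - t))%:E =
   (Num.sqrt (v / (v + s2)) * gauss_kernel (v + s2) t)%:E)%E.
Proof.
elim: l v => [|i l IH] v ul v0 /=.
  rewrite big_nil addr0 divff ?gt_eqF// sqrtr1 mul1r.
  under eq_integral do rewrite /lincomb big_nil sub0r /gauss_kernel sqrrN.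
  by rewrite integral_cst//= probability_setT mule1.
set s2 := \sum_(j <- l) a j ^+ 2.
have s20 : 0 <= s2 by rewrite sumr_ge0// => j _; exact: sqr_ge0.
have w0 : 0 < v + a i ^+ 2 by rewrite ltr_wpDr ?sqr_ge0.
pose S := lincomb Y a l; pose h om := (S om, Y i om).
have mh : measurable_fun setT h by exact: measurable_fun_pair.
pose F (p : measurableTypeR R * measurableTypeR R) : \bar R :=
  (gauss_kernel v (a i * p.2 + (p.1 - t)))%:E.
have mF : measurable_fun setT F.
  apply/measurable_EFinP; rewrite /gauss_kernel.
  do 2 apply: measurableT_comp => //=.
  apply: measurable_funM => //; apply: measurable_funX.
  apply: measurable_funD; first exact: measurable_funM.
  exact: measurable_funB.
have F0 p : (0 <= F p)%E by rewrite lee_fin gauss_kernel_ge0.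
transitivity (\int[Pr]_om (F \o h) om)%E.
  apply: eq_integral => om _; congr ((gauss_kernel v _)%:E).
  by rewrite /h /S /lincomb big_cons/= addrA.
transitivity (\int[pushforward Pr h]_p F p)%E.
  by rewrite (ge0_integral_pushforward mh)// => p _.
rewrite (eq_measure_integral (distribution Pr S \x distribution Pr (Y i))%E); last first.
  move=> X mX _; rewrite -[LHS]/(Pr (h @^-1` X)) -[h @^-1` X]setIT.
  rewrite -[RHS]mul1e -(@probability_setT _ _ _ Pr).
  apply: (@joint_law _ _ _ Pr S (Y i)) => //; rewrite probability_setT.
  move=> A C mA mC; rewrite setIT mule1.
  have := @independent_lincomb _ _ _ _ _ Y a indepY l [:: i] A (fun=> C).
  have -> : \bigcap_(i0 in [set` [:: i]]) Y i0 @^-1` C = Y i @^-1` C.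
    apply/seteqP; split=> om /=; first by apply; rewrite /= inE.
    by move=> Cy j; rewrite /= inE => /eqP ->.
  by apply=> //; rewrite cats1 rcons_uniq; move: ul.
rewrite fubini_tonelli1//.
have inner x : fubini_F (distribution Pr (Y i)) F x =
    ((Num.sqrt (v / (v + a i ^+ 2)))%:E *
     (gauss_kernel (v + a i ^+ 2) (x - t))%:E)%E.
  rewrite /fubini_F (eq_measure_integral (normal_prob 0 1)).
    by rewrite -EFinM -(integral_gauss_kernel (a i) (x - t) v0).
  by move=> A mA _; exact: normalY.
have mk : measurable_fun setT (fun x : measurableTypeR R =>
    (gauss_kernel (v + a i ^+ 2) (x - t))%:E).
  apply/measurable_EFinP.
  have := @measurable_gauss_kernel R (v + a i ^+ 2) 1 (- t).
  by under eq_fun do rewrite mul1r.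
under eq_integral do rewrite inner.
rewrite ge0_integralZl//; last first.
  by move=> x _; rewrite lee_fin gauss_kernel_ge0.
rewrite ge0_integral_distribution//; last first.
  by move=> x; rewrite lee_fin gauss_kernel_ge0.
rewrite [X in (_ * X)%E](IH _ _ w0); last by case/andP: ul.
rewrite -EFinM mulrA -sqrtrM ?divr_ge0 ?ltW// big_cons -/s2 addrA.
congr ((Num.sqrt _ * _)%:E); field.
by rewrite !gt_eqF// ltr_wpDr.
Qed.

End gaussian_lincomb.

(** * Continuity and Borel measurability on column vectors *)

Section euclidean_topology.
Context {R : realType} {n : nat}.

Lemma continuous_coord_sum (F : 'I_n -> R -> R) : (forall i, continuous (F i)) ->
  continuous (fun x : 'cV[R]_n => \sum_i F i (x i 0)).
Proof.
move=> cF; have ci i : continuous (fun x : 'cV[R]_n => F i (x i 0)).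
  move=> x; apply: (@continuous_comp _ _ _ (fun y : 'cV[R]_n => y i 0) (F i)).
    exact: coord_continuous.
  exact: cF.
elim: (index_enum _) => [|i s IH] x.
  rewrite (_ : (fun _ => _) = cst 0); first exact: cst_continuous.
  by apply/funext => y; rewrite big_nil.
rewrite (_ : (fun _ => _) =
    (fun y : 'cV[R]_n => F i (y i 0) + \sum_(j <- s) F j (y j 0))).
  exact: (continuousD (ci i x) (IH x)).
by apply/funext => y; rewrite big_cons.
Qed.

Lemma continuous_enorm : continuous (@enorm R n).
Proof.
move=> x; apply: (@continuous_comp _ _ _ (fun x : 'cV[R]_n => \sum_i x i 0 ^+ 2)).
  by apply: (@continuous_coord_sum (fun _ y => y ^+ 2)) => _; exact: exprn_continuous.
exact: sqrt_continuous.
Qed.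

Lemma continuous_row (b : 'rV[R]_n) :
  continuous (fun x : 'cV[R]_n => (b *m x) 0 0).
Proof.
rewrite (_ : (fun _ => _) = (fun x : 'cV[R]_n => \sum_i b 0 i * x i 0)).
  by apply: (@continuous_coord_sum (fun i y => b 0 i * y)) => i; exact: mulrl_continuous.
by apply/funext => x; rewrite mxE.
Qed.

Lemma open_measurable_cV (A : set 'cV[R]_n) :
  open A -> measurable (A : set (borel_cV R n)).
Proof. by move=> oA; exact: sub_sigma_algebra. Qed.

Lemma closed_measurable_cV (A : set 'cV[R]_n) :
  closed A -> measurable (A : set (borel_cV R n)).
Proof.
by move=> /closed_openC/open_measurable_cV/measurableC; rewrite setCK.
Qed.

Lemma continuous_measurable_cV (f : 'cV[R]_n -> R) : continuous f ->
  measurable_fun setT (f : borel_cV R n -> measurableTypeR R).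
Proof.
move=> /continuousP cf; apply: (measurability _ (RGenOpens.measurableE R)).
move=> _ [_ [a [b ->] <-]]; rewrite setTI.
by apply: open_measurable_cV; apply: cf; exact: interval_open.
Qed.

Lemma measurable_preimage d (Om : measurableType d) (X : Om -> 'cV[R]_n)
  (A : set (borel_cV R n)) :
  random_vector X -> measurable A -> measurable (X @^-1` A).
Proof. by move=> mX mA; rewrite -[X in measurable X]setTI; exact: mX. Qed.

End euclidean_topology.

(** * Anti-concentration, unboundedness and tails of a standard Gaussian vector *)

Section gaussian_vector.
Context {R : realType} (q : nat) d {Om : measurableType d} (Pr : probability Om R).
Variable Y : Om -> 'cV[R]_q.
Hypothesis gY : std_gaussian Pr Y.

Let mY i : measurable_fun setT (fun om => Y om i 0 : measurableTypeR R).
Proof.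
have [rvY _ _] := gY.
apply: (@measurableT_comp _ _ _ _ _ _
  (fun x : borel_cV R q => x i 0 : measurableTypeR R)) rvY.
exact: continuous_measurable_cV (@coord_continuous _ _ _ i 0).
Qed.

Lemma measurable_row (b : 'rV[R]_q) :
  measurable_fun setT (fun om => (b *m Y om) 0 0 : measurableTypeR R).
Proof.
have [rvY _ _] := gY; apply: (@measurableT_comp _ _ _ _ _ _
  (fun x : borel_cV R q => (b *m x) 0 0 : measurableTypeR R)) rvY.
exact: continuous_measurable_cV (@continuous_row _ _ b).
Qed.

Lemma expectation_gauss_kernel_row (b : 'rV[R]_q) (v t : R) : 0 < v ->
  let s2 := enorm b^T ^+ 2 in
  (\int[Pr]_om (gauss_kernel v ((b *m Y om) 0 0 - t))%:E =
   (Num.sqrt (v / (v + s2)) * gauss_kernel (v + s2) t)%:E)%E.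
Proof.
move=> v0 /=; have [_ normY indepY] := gY.
pose Y' (i : 'I_q) : {RV Pr >-> measurableTypeR R} :=
  HB.pack (fun om => Y om i 0 : measurableTypeR R)
    (isMeasurableFun.Build _ _ _ _ _ (mY i)).
have := @expectation_gauss_kernel _ _ _ Pr _ Y' normY indepY (fun i => b 0 i)
  (index_enum 'I_q) v t (index_enum_uniq _) v0.
have -> : \sum_(i <- index_enum 'I_q) b 0 i ^+ 2 = enorm b^T ^+ 2.
  by rewrite sqr_enorm; apply: eq_bigr => i _; rewrite mxE.
by move=> /= <-; apply: eq_integral => om _; rewrite /lincomb mxE.
Qed.

(** A kernel of variance e^2 centred at t is at least 1/2 on the interval, so the probability is at
    most twice its mean, which is at most sqrt (e^2 / (e^2 + |b|^2)) <= e / |b|. *)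
Lemma gaussian_anticoncentration (b : 'rV[R]_q) (t e : R) :
  0 <= e -> 0 < enorm b^T ->
  (Pr [set om | (t - e <= (b *m Y om) 0 0 < t)%R] <= (2 * (e / enorm b^T))%:E)%E.
Proof.
move=> e0 b0; set A := [set om | _].
(* The kernel needs a positive variance e^2; for e = 0 the interval is empty. *)
have [e00|eN0] := eqVneq e 0.
  have -> : A = set0.
    apply/seteqP; split => // om; rewrite /A/= e00 subr0.
    by move=> /andP[/le_lt_trans/[apply]]; rewrite ltxx.
  by rewrite measure0 e00 mul0r mulr0.
have ep : 0 < e by rewrite lt_neqAle eq_sym eN0.
have v0 : 0 < e ^+ 2 by rewrite exprn_gt0.
have mA : measurable A.
  have -> : A = (fun om => (b *m Y om) 0 0 : measurableTypeR R) @^-1` `[t - e, t[.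
    by apply/seteqP; split=> om; rewrite /A/= in_itv.
  by rewrite -[X in measurable X]setTI; exact: measurable_row.
have mk : measurable_fun setT
    (fun om => (gauss_kernel (e ^+ 2) ((b *m Y om) 0 0 - t))%:E).
  apply/measurable_EFinP.
  have := measurableT_comp (@measurable_gauss_kernel R (e ^+ 2) 1 (- t)) (measurable_row b).
  by rewrite /comp; under eq_fun do rewrite mul1r.
rewrite -[A]setIT -integral_indic//.
apply: (@le_trans _ _ (\int[Pr]_om
    (2%:E * (gauss_kernel (e ^+ 2) ((b *m Y om) 0 0 - t))%:E))%E).
  apply: ge0_le_integral => //.
  - by apply/measurable_EFinP; exact: measurable_indic.
  - exact: measurable_funeM.
  move=> om _; rewrite -EFinM lee_fin indicE.
  have [/set_mem|_] := boolP (om \in A); last first.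
    by rewrite mulr_ge0 ?gauss_kernel_ge0.
  rewrite /A/= => /andP[h1 h2]; set w := _ - t.
  have we : w ^+ 2 <= e ^+ 2.
    by rewrite -[w ^+ 2]sqrrN lerXn2r ?nnegrE// /w; lra.
  (* From 1 + x <= exp x, with x >= - 1/2 on the interval. *)
  have : 1 - 1 / 2 <= gauss_kernel (e ^+ 2) w.
    apply: le_trans (expR_ge1Dx _); rewrite lerD2l lerN2.
    by rewrite ler_pdivrMr ?mulr_gt0//; lra.
  by rewrite mulr1n; lra.
rewrite ge0_integralZl//; last first.
  by move=> om _; rewrite lee_fin gauss_kernel_ge0.
rewrite expectation_gauss_kernel_row// -EFinM lee_fin ler_wpM2l//.
have w0 : 0 < e ^+ 2 + enorm b^T ^+ 2 by rewrite ltr_wpDr ?sqr_ge0.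
apply: (@le_trans _ _ (Num.sqrt (e ^+ 2 / (e ^+ 2 + enorm b^T ^+ 2)))).
  by rewrite ler_piMr ?sqrtr_ge0// gauss_kernel_le1.
have -> : e / enorm b^T = Num.sqrt (e ^+ 2 / enorm b^T ^+ 2).
  by rewrite -expr_div_n sqrtr_sqr ger0_norm// divr_ge0// ltW.
apply/ler_wsqrtr/(ler_wpM2l (ltW v0)).
by rewrite lef_pV2 ?posrE ?exprn_gt0// lerDr ltW.
Qed.

(** If |W| <= C almost surely, with C >= s and u = C^2 / s^2, a kernel of variance s^2 centred at a
    C has mean at most exp(- (a - 1)^2 u / 2), while the exact mean is exp(- a^2 u / 4) / sqrt 2.
    The choice a = 4 gives the exponents 9 u / 2 and 4 u, which are incompatible for u >= 1. *)
Lemma gaussian_unbounded (b : 'rV[R]_q) (B : R) : 0 < enorm b^T ->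
  Pr [set om | `|(b *m Y om) 0 0| <= B] <> 1%E.
Proof.
move=> b0 PB; set s := enorm b^T in b0; pose C := Num.max B s.
have Cs : s <= C by rewrite le_max lexx orbT.
have BC : B <= C by rewrite le_max lexx.
have C0 : 0 < C by apply: lt_le_trans Cs.
have v0 : 0 < s ^+ 2 by rewrite exprn_gt0.
set A := [set om | _] in PB.
have mW := measurable_row b.
have mA : measurable A.
  have -> : A = (fun om => (b *m Y om) 0 0 : measurableTypeR R) @^-1` `[- B, B].
    by apply/seteqP; split=> om; rewrite /A/= in_itv/= ler_norml.
  by rewrite -[X in measurable X]setTI; exact: mW.
have PCA : Pr (~` A) = 0%E by rewrite probability_setC// PB subee.
pose y := expR (- (9 * C ^+ 2 / (2 * s ^+ 2))).
have := @expectation_gauss_kernel_row b (s ^+ 2) (4 * C) v0.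
rewrite -/s => /= E.
have : (\int[Pr]_om (gauss_kernel (s ^+ 2) ((b *m Y om) 0 0 - 4 * C))%:E <= y%:E)%E.
  apply: (@le_trans _ _ (\int[Pr]_om (y%:E * (\1_A om)%:E + (\1_(~` A) om)%:E))%E).
    apply: ge0_le_integral => //.
    - by move=> om _; rewrite lee_fin gauss_kernel_ge0.
    - apply/measurable_EFinP.
      have := measurableT_comp (@measurable_gauss_kernel R (s ^+ 2) 1 (- (4 * C))) mW.
      by rewrite /comp; under eq_fun do rewrite mul1r.
    - apply: emeasurable_funD; first apply: measurable_funeM;
        by apply/measurable_EFinP; apply: measurable_indic => //; exact: measurableC.
    move=> om _; rewrite -EFinM -EFinD lee_fin !indicE in_setC.
    have [/set_mem|_] := boolP (om \in A); last first.
      by rewrite mulr0 add0r gauss_kernel_le1.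
    rewrite /A/= mulr1 addr0 => /(le_trans (ler_norm _)) wB.
    rewrite ler_expR lerN2 ler_pM2r ?invr_gt0 ?mulr_gt0//.
    by set w := (b *m Y om) 0 0 in wB *; nra.
  rewrite ge0_integralD//; last 3 first.
  - by move=> om _; rewrite mule_ge0// lee_fin ?expR_ge0.
  - by apply: measurable_funeM; apply/measurable_EFinP; exact: measurable_indic.
  - by apply/measurable_EFinP; apply: measurable_indic; exact: measurableC.
  rewrite ge0_integralZl//; last 2 first.
  - by apply/measurable_EFinP; exact: measurable_indic.
  - by rewrite lee_fin expR_ge0.
  rewrite !integral_indic//; last exact: measurableC.
  by rewrite !setIT [X in (_ * X)%E]PB [X in (_ + X)%E]PCA mule1 adde0.
rewrite E lee_fin.
pose u := C ^+ 2 / s ^+ 2.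
have u1 : 1 <= u by rewrite ler_pdivlMr// mul1r ler_pXn2r// nnegrE ltW.
have sN0 : s != 0 by rewrite gt_eqF.
have -> : y = expR (- (4 * u)) * expR (- (u / 2)).
  by rewrite -expRD; congr expR; rewrite /u; field.
have -> : s ^+ 2 + s ^+ 2 = 2 * s ^+ 2 by ring.
have -> : gauss_kernel (2 * s ^+ 2) (4 * C) = expR (- (4 * u)).
  by rewrite /gauss_kernel; congr expR; rewrite /u; field.
rewrite mulrC ler_pM2l ?expR_gt0//.
have -> : s ^+ 2 / (2 * s ^+ 2) = 2^-1 by field.
(* Since u >= 1, exp(- u / 2) <= 1 / (1 + u / 2) <= 2/3, and 2/3 < 1 / sqrt 2 because 4/9 < 1/2. *)
have eu : expR (- (u / 2)) <= 2 / 3.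
  rewrite expRN -[leRHS]invf_div lef_pV2 ?posrE ?expR_gt0//.
  by apply: le_trans (expR_ge1Dx _); lra.
move=> h; have h2 : Num.sqrt (2^-1) <= 2 / 3 :> R := le_trans h eu.
have : Num.sqrt (2^-1 : R) ^+ 2 = 2^-1 by rewrite sqr_sqrtr.
have : 0 <= Num.sqrt (2^-1 : R) := sqrtr_ge0 _.
by nra.
Qed.

Let exceed (s : R) (i : 'I_q) : set Om := [set om | s < `|Y om i 0|].

Let measurable_exceed s i : measurable (exceed s i).
Proof.
rewrite (_ : exceed s i = (fun om => Y om i 0 : measurableTypeR R) @^-1`
    [set x | s < `|x|])//.
by rewrite -[X in measurable X]setTI; apply: mY => //; exact: measurable_normr_gt.
Qed.

Let exceedE s : [set om | exists i, s < `|Y om i 0|] =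
  \big[setU/set0]_(i <- index_enum 'I_q) exceed s i.
Proof.
rewrite -bigcup_seq; apply/seteqP; split=> om /=.
  by move=> [i si]; exists i => //=; exact: mem_index_enum.
by move=> [i _ si]; exists i.
Qed.

Lemma measurable_coord_tail s : measurable [set om | exists i, s < `|Y om i 0|].
Proof. by rewrite exceedE; exact: bigsetU_measurable. Qed.

Lemma gaussian_coord_tail (s : R) : 0 <= s ->
  (Pr [set om | exists i, (s < `|Y om i 0|)%R] <=
   (q%:R * (2 * expR (- (s ^+ 2 / 2))))%:E)%E.
Proof.
move=> s0; have [_ normY _] := gY; rewrite exceedE.
pose c : R := 2 * expR (- (s ^+ 2 / 2)).
apply: (@le_trans _ _ (\sum_(i <- index_enum 'I_q) c%:E)%E).
  elim: (index_enum _) => [|i l IH]; first by rewrite !big_nil measure0.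
  rewrite !big_cons (le_trans (measureU2 _ _ _))//; first exact: bigsetU_measurable.
  apply: leeD => //; apply: le_trans (normal_prob_tail s0).
  by rewrite -(normY i)//; exact: measurable_normr_gt.
by rewrite sumEFin sumr_const card_ord -[(_ *+ q)%R]mulr_natl.
Qed.

End gaussian_vector.

(** * Moment bounds *)

Section moments.
Context {R : realType} d {T : measurableType d} (P : probability T R).
Implicit Types X Y e : T -> R.

Lemma Lnorm4_le e (s : R) : 0 <= s -> ('N[P]_4%:E[EFin \o e] <= s%:E)%E ->
  (\int[P]_x (e x ^+ 4)%:E <= (s ^+ 4)%:E)%E.
Proof.
move=> s0 Ns.
have p4 (a : R) : 0 <= a -> a `^ 4 = a ^+ 4.
  by move=> a0; rewrite -powR_mulrn.
have -> : (s ^+ 4)%:E = (s%:E `^ 4)%E by rewrite poweR_EFin p4.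
have -> : (\int[P]_x (e x ^+ 4)%:E = 'N[P]_4%:E[EFin \o e] `^ 4)%E.
  rewrite poweR_Lnorm//; apply: eq_integral => x _.
  rewrite [RHS](_ : _ = (`|e x| `^ 4)%:E)// p4//; congr (_%:E).
  by rewrite -normrX ger0_norm// -[4%N]/(2 * 2)%N exprM sqr_ge0.
apply: gt0_ler_poweR => //; first by rewrite in_itv/= leey Lnorm_ge0.
by rewrite in_itv/= leey lee_fin s0.
Qed.

Lemma norm_fine_integral_le X e (c : R) : measurable_fun setT X ->
  measurable_fun setT e -> (forall x, `|X x| <= e x) ->
  (\int[P]_x (e x)%:E <= c%:E)%E -> `|fine (\int[P]_x (X x)%:E)%E| <= c.
Proof.
move=> mX me Xe ec.
have absX : (`|\int[P]_x (X x)%:E| <= c%:E)%E.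
  apply: le_trans ec; apply: le_trans (le_abse_integral _ _ _) _ => //.
    exact/measurable_EFinP.
  apply: ge0_le_integral => //.
  - by apply: measurableT_comp => //; exact/measurable_EFinP.
  - exact/measurable_EFinP.
  - by move=> x _; rewrite /= lee_fin.
move: absX; case: (\int[P]_x (X x)%:E)%E => [r|//|//] /=.
by rewrite lee_fin.
Qed.

(* AM-GM gives [e <= (e ^ 4 / s ^ 3 + 3 s) / 4] and
   [2 e ^ 2 <= e ^ 4 / s ^ 2 + s ^ 2]. *)
Lemma norm_covariance_le X Y e (s : R) : 0 < s ->
  measurable_fun setT X -> measurable_fun setT Y -> measurable_fun setT e ->
  (forall x, `|X x| <= e x) -> (forall x, `|Y x| <= e x) ->
  (\int[P]_x (e x ^+ 4)%:E <= (s ^+ 4)%:E)%E ->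
  `|fine (covariance P X Y)| <= 4 * s ^+ 2.
Proof.
move=> s0 mX mY me Xe Ye e4.
have e0 x : 0 <= e x by apply: le_trans (Xe x).
have me4 : measurable_fun setT (fun x => e x ^+ 4) by exact: measurable_funX.
have affine (a b : R) : 0 <= a -> 0 <= b ->
    (\int[P]_x (a * e x ^+ 4 + b)%:E <= (a * s ^+ 4 + b)%:E)%E.
  move=> a0 b0; under eq_integral do rewrite EFinD EFinM.
  rewrite ge0_integralD//; last 2 first.
  - by move=> x _; rewrite mule_ge0// lee_fin exprn_ge0.
  - by apply: measurable_funeM; exact/measurable_EFinP.
  rewrite ge0_integralZl//; last 2 first.
  - exact/measurable_EFinP.
  - by move=> x _; rewrite lee_fin exprn_ge0.
  rewrite integral_cst//= probability_setT mule1 EFinD leeD2r//.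
  by rewrite EFinM lee_wpmul2l.
have E1 X' : measurable_fun setT X' -> (forall x, `|X' x| <= e x) ->
    `|fine ('E_P[X'])%E| <= s.
  move=> mX' X'e; rewrite unlock.
  apply: (@norm_fine_integral_le X' (fun x => 4^-1 / s ^+ 3 * e x ^+ 4 + 3 / 4 * s)) => //.
  - by apply: measurable_funD => //; exact: measurable_funM.
  - move=> x; apply: le_trans (X'e x) _; rewrite -subr_ge0.
    (* The defect in AM-GM is y^4 - 4 s^3 y + 3 s^4 up to a positive factor; y = s is a double
       root. *)
    have -> : 4^-1 / s ^+ 3 * e x ^+ 4 + 3 / 4 * s - e x =
        (e x - s) ^+ 2 * (e x ^+ 2 + 2 * e x * s + 3 * s ^+ 2) / (4 * s ^+ 3).
      by field; rewrite gt_eqF.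
    have := e0 x; set y := e x => y0.
    have s3 : 0 < 4 * s ^+ 3 by rewrite mulr_gt0// exprn_gt0.
    have ys : 0 <= y ^+ 2 + 2 * y * s + 3 * s ^+ 2.
      by have := mulr_ge0 y0 (ltW s0); nra.
    exact: divr_ge0 (mulr_ge0 (sqr_ge0 _) ys) (ltW s3).
  - apply: le_trans (affine _ _ _ _) _.
    + by rewrite divr_ge0// exprn_ge0// ltW.
    + by rewrite mulr_ge0// ltW.
    + rewrite lee_fin le_eqVlt; apply/orP; left; apply/eqP; field.
      by rewrite gt_eqF.
rewrite covariance.unlock; set x0 := fine 'E_P[X]; set y0 := fine 'E_P[Y].
rewrite expectation.unlock.
(* Origin of the 4: (e + s)^2 <= 2 e^2 + 2 s^2 <= e^4 / s^2 + 3 s^2, and the last expression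
   integrates to at most s^2 + 3 s^2. *)
apply: (@norm_fine_integral_le _ (fun x => (s ^+ 2)^-1 * e x ^+ 4 + 3 * s ^+ 2)) => //.
- by apply: measurable_funM; exact: measurable_funB.
- by apply: measurable_funD => //; exact: measurable_funM.
- move=> x; rewrite [Z in `|Z|](_ : _ = (X x - x0) * (Y x - y0))// normrM.
  have h1 : `|X x - x0| <= e x + s.
    by apply: le_trans (ler_normB _ _) _; apply: lerD => //; exact: E1.
  have h2 : `|Y x - y0| <= e x + s.
    by apply: le_trans (ler_normB _ _) _; apply: lerD => //; exact: E1.
  apply: (@le_trans _ _ ((e x + s) ^+ 2)).
    by rewrite expr2; apply: ler_pM.
  apply: (@le_trans _ _ (2 * e x ^+ 2 + 2 * s ^+ 2)).
    by rewrite -subr_ge0; have := sqr_ge0 (e x - s); nra.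
  rewrite -subr_ge0.
  have -> : (s ^+ 2)^-1 * e x ^+ 4 + 3 * s ^+ 2 - (2 * e x ^+ 2 + 2 * s ^+ 2) =
      (e x ^+ 2 - s ^+ 2) ^+ 2 / s ^+ 2 by field; rewrite gt_eqF.
  by rewrite divr_ge0 ?sqr_ge0.
- apply: le_trans (affine _ _ _ _) _.
  + by rewrite invr_ge0 sqr_ge0.
  + by rewrite mulr_ge0 ?sqr_ge0.
  + rewrite lee_fin le_eqVlt; apply/orP; left; apply/eqP; field.
    by rewrite gt_eqF.
Qed.

(* When both parts are infinite, [+oo - +oo = -oo] and both sides are 0. *)
Lemma fine_integralN X : fine (\int[P]_x (- X x)%:E)%E = - fine (\int[P]_x (X x)%:E)%E.
Proof.
rewrite integralE [in RHS]integralE.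
have -> : (fun x => (- X x)%:E) = (\- (EFin \o X))%E by apply/funext => x.
rewrite funeposN funenegN -[(fun x => (X x)%:E)]/(EFin \o X).
have : (0 <= \int[P]_x (EFin \o X)^\+ x)%E by exact: integral_ge0.
have : (0 <= \int[P]_x (EFin \o X)^\- x)%E by exact: integral_ge0.
case: (\int[P]_x _)%E => [a|//|//]; case: (\int[P]_x _)%E => [b|//|//] //= _ _;
  by rewrite ?opprB ?oppr0.
Qed.

End moments.

(** * Norm bound for the square root of a sandwich covariance *)

Section sandwich.
Context {R : realType} (q : nat).

(** By the symmetry of [M] and [G], |M x|^2 is the form of [V] at G^{-1} x, the two minus signs
    cancelling; [form_le] and the coercivity of [G] bound it. The sign is there because [G] will be
    the Hessian of the expected loss, whereas the covariance is written with the log-likelihood. *)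
Lemma opnorm_sandwich_le (G V M : 'M[R]_q) (mu c : R) : 0 < mu -> 0 <= c ->
  G^T = G -> (forall x, mu * enorm x ^+ 2 <= (x^T *m G *m x) 0 0) ->
  (forall i j, `|V i j| <= c) ->
  M^T = M -> M *m M = invmx (- G) *m V *m invmx (- G) ->
  opnorm M ^+ 2 <= c * q%:R / mu ^+ 2.
Proof.
move=> mu0 c0 GT Gmu Vc MT MM.
have [Gu Ginv] := coercive_unitmx mu0 Gmu.
have NGu : -1 *: G \in unitmx.
  by rewrite unitmxE detZ unitrM -unitmxE Gu andbT unitrX// unitrN1.
have NG : invmx (- G) = - invmx G by rewrite -scaleN1r invmxZ// invrN1 scaleN1r.
have GTi : (invmx G)^T = invmx G by rewrite trmx_inv GT.
have D0 : 0 <= c * q%:R / mu ^+ 2 by rewrite divr_ge0 ?sqr_ge0// mulr_ge0.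
rewrite -(sqr_sqrtr D0) lerXn2r ?nnegrE ?opnorm_ge0 ?sqrtr_ge0//.
apply: opnorm_le => [|x]; first exact: sqrtr_ge0.
rewrite -(@ler_pXn2r _ 2) ?nnegrE ?mulr_ge0 ?enorm_ge0 ?sqrtr_ge0//.
rewrite exprMn (sqr_sqrtr D0).
have -> : enorm (M *m x) ^+ 2 = ((invmx G *m x)^T *m V *m (invmx G *m x)) 0 0.
  rewrite -dot_sqr_enorm trmx_mul MT mulmxA -(mulmxA _ M M) MM NG.
  by rewrite trmx_mul GTi !mulmxA !(mulmxN, mulNmx) opprK.
apply: le_trans (form_le _ Vc) _.
rewrite -[leRHS]mulrA; apply: ler_wpM2l; first by rewrite mulr_ge0.
rewrite -exprVn -exprMn lerXn2r ?nnegrE ?enorm_ge0//.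
by rewrite mulr_ge0 ?enorm_ge0// invr_ge0 ltW.
Qed.

End sandwich.

(** * Comparisons with the Berry-Esseen term *)

Section real_bounds.
Context {R : realType}.

(** The exponent 1/3 is chosen so that q^3 ln n >= n still gives q^3 >= n^{2/3} up to a constant,
    which is what the exponent 9/4 requires. *)
Lemma ln_le_cube_root (x : R) : 0 < x -> ln x <= 3 * x `^ 3^-1.
Proof.
move=> x0; have -> : ln x = 3 * ln (x `^ 3^-1).
  by rewrite ln_powR mulrA divff// mul1r.
by rewrite ler_pM2l// ltW// ln_sublinear// powR_gt0.
Qed.

(* [s = ||M1|| sqrt (q ln n)] reaches radius [r] only once [q^{9/4} n^{-1/2}]
   is of order one. *)
Lemma be_term_lower_bound (C r b m : R) (q n : nat) :
  0 <= C -> 0 < r -> 0 < b -> (0 < n)%N ->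
  m ^+ 2 <= b * q%:R ^+ 2 ->
  r * Num.sqrt n%:R <= m * Num.sqrt (q%:R * ln n%:R) ->
  C * (r ^+ 2 / (3 * b)) `^ (3 / 4) <= be_term q C n.
Proof.
move=> C0 r0 b0 n0 mb rm.
have N0 : 0 < n%:R :> R by rewrite ltr0n.
set N := n%:R in rm N0 *; set Q : R := q%:R in mb rm *.
have Q0 : 0 <= Q by rewrite ler0n.
have ln0 : 0 <= ln N by rewrite ln_ge0// ler1n.
pose c := N `^ 3^-1.
have c0 : 0 < c by rewrite powR_gt0.
have c3 : c ^+ 3 = N.
  by rewrite -powR_mulrn ?ltW// -powRrM mulVf// powRr1// ltW.
have lnc : ln N <= 3 * c by exact: ln_le_cube_root.
have h1 : r ^+ 2 * N <= b * Q ^+ 3 * (3 * c).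
  have rN0 : 0 <= r * Num.sqrt N by rewrite mulr_ge0 ?sqrtr_ge0// ltW.
  have : (r * Num.sqrt N) ^+ 2 <= (m * Num.sqrt (Q * ln N)) ^+ 2.
    by rewrite lerXn2r ?nnegrE// (le_trans rN0).
  rewrite !exprMn !sqr_sqrtr ?mulr_ge0// ?(ltW N0)// => /le_trans; apply.
  apply: (@le_trans _ _ (b * Q ^+ 2 * (Q * ln N))).
    by apply: ler_wpM2r => //; exact: mulr_ge0.
  rewrite -[leRHS]mulrA -[leLHS]mulrA ler_pM2l// mulrA -exprSr.
  by rewrite ler_wpM2l// exprn_ge0.
have h2 : r ^+ 2 / (3 * b) * c ^+ 2 <= Q ^+ 3.
  rewrite mulrAC ler_pdivrMr ?mulr_gt0// -(ler_pM2r c0) -mulrA -exprSr c3.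
  by apply: le_trans h1 _; rewrite le_eqVlt; apply/orP; left; apply/eqP; ring.
have k0 : 0 <= r ^+ 2 / (3 * b) by rewrite divr_ge0 ?sqr_ge0// mulr_ge0// ltW.
rewrite /be_term -[leRHS]mulrA ler_wpM2l// ler_pdivlMr ?sqrtr_gt0//.
(* The power 3/4 turns c^2 = N^{2/3} into sqrt N and Q^3 into Q^{9/4}. *)
have -> : Num.sqrt N = (c ^+ 2) `^ (3 / 4).
  rewrite -powR12_sqrt ?(ltW N0)// -powR_mulrn ?(ltW c0)// -!powRrM.
  by congr (_ `^ _); field.
have -> : q%:R `^ (9%:R / 4%:R) = (Q ^+ 3) `^ (3 / 4).
  by rewrite -powR_mulrn// -powRrM; congr (_ `^ _); field.
rewrite -powRM ?sqr_ge0//; apply: ge0_ler_powR => //.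
- by rewrite nnegrE mulr_ge0 ?sqr_ge0.
- by rewrite nnegrE exprn_ge0.
Qed.

(** Absorbs the Gaussian tail 2 q / sqrt n into the Berry-Esseen term; q >= 1 lets the exponent 1
    grow to 9/4. *)
Lemma be_term_ge (C : R) (q n : nat) : 0 <= C -> (0 < q)%N ->
  C * (q%:R / Num.sqrt n%:R) <= be_term q C n.
Proof.
move=> C0 q0; rewrite /be_term mulrA ler_wpM2r ?invr_ge0 ?sqrtr_ge0// ler_wpM2l//.
rewrite -[leLHS]powRr1 ?ler0n//; apply: ler_powR; first by rewrite ler1n.
by rewrite ler_pdivlMr//; lra.
Qed.

End real_bounds.

(** * Bounded and convex sets of column vectors *)

Section bounded_euclidean.
Context {R : realType}.

Lemma bounded_enorm q (A : set 'cV[R]_q) : bounded_set A ->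
  exists C : R, forall x, A x -> enorm x <= C.
Proof.
move=> [M0 [_ M0A]]; have M1 : M0 < `|M0| + 1.
  by rewrite (le_lt_trans (ler_norm _))// ltrDl.
exists (Num.sqrt q%:R * (`|M0| + 1)) => x Ax.
apply: enorm_le_coord => [|i]; first by rewrite addr_ge0.
apply: le_trans (M0A _ M1 x Ax).
by rewrite [leRHS]/Num.Def.normr/= mx_normrE; apply/bigmax_geP; right => /=; exists (i, 0).
Qed.

Lemma convex_setE q (A : set 'cV[R]_q) :
  (forall x y (k : R), 0 <= k <= 1 -> A x -> A y -> A (k *: x + (1 - k) *: y)) ->
  convex_set (A : set (convex_lmodType 'cV[R]_q)).
Proof.
move=> cA x y k /set_mem Ax /set_mem Ay; apply/mem_set.
by apply: cA => //; rewrite ge0 le1.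
Qed.

Lemma convex_enorm_ball q (s : R) :
  convex_set ([set x | enorm x <= s] : set (convex_lmodType 'cV[R]_q)).
Proof.
apply: convex_setE => x y k /andP[k0 k1] /= xs ys.
apply: le_trans (enormD _ _) _; rewrite !enormZ !ger0_norm ?subr_ge0//.
have -> : s = k * s + (1 - k) * s by ring.
by apply: lerD; apply: ler_wpM2l => //; rewrite subr_ge0.
Qed.

Lemma convex_halfspace q (b : 'rV[R]_q) (t : R) :
  convex_set ([set x | t <= (b *m x) 0 0] : set (convex_lmodType 'cV[R]_q)).
Proof.
apply: convex_setE => x y k /andP[k0 k1] /= xt yt.
have -> : (b *m (k *: x + (1 - k) *: y)) 0 0 =
    k * (b *m x) 0 0 + (1 - k) * (b *m y) 0 0.
  have mxDZ (B C : 'M[R]_1) (l m : R) :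
      (l *: B + m *: C) 0 0 = l * B 0 0 + m * C 0 0 by rewrite !mxE.
  by rewrite mulmxDr -!scalemxAr mxDZ.
have {1}-> : t = k * t + (1 - k) * t by ring.
by apply: lerD; apply: ler_wpM2l => //; rewrite subr_ge0.
Qed.

End bounded_euclidean.

(** * Measurable events and real-valued probabilities *)

Section random_vectors.
Context {R : realType} d {Om : measurableType d}.

Lemma continuous_measurable_cV_cV n m (f : 'cV[R]_n -> 'cV[R]_m) : continuous f ->
  measurable_fun setT (f : borel_cV R n -> borel_cV R m).
Proof.
move=> /continuousP cf; have mE : @measurable _ (borel_cV R m) = <<s @open 'cV[R]_m >> by [].
apply: (measurability _ mE).
by move=> _ [A oA <-]; rewrite setTI; apply: open_measurable_cV; exact: cf.
Qed.

Lemma random_vector_affine n (X : Om -> 'cV[R]_n) (c : R) (x0 : 'cV[R]_n) :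
  random_vector X -> random_vector (fun om => c *: (X om - x0)).
Proof.
move=> mX; apply: (@measurableT_comp _ _ _ _ _ _
  (fun x : borel_cV R n => c *: (x - x0) : borel_cV R n)) mX.
apply: continuous_measurable_cV_cV => x.
have cB : (fun y : 'cV[R]_n => y - x0) @ x --> x - x0.
  exact: (@cvgB _ _ _ _ _ id (cst x0) x x0 (fun A => id) (cvg_cst x0)).
exact: (@cvgZl_tmp _ _ _ _ _ c _ _ cB).
Qed.

Lemma measurable_enorm_ball n (s : R) :
  measurable ([set x | enorm x <= s] : set (borel_cV R n)).
Proof.
apply: closed_measurable_cV.
have -> : [set x : 'cV[R]_n | enorm x <= s] = @enorm R n @^-1` [set y | y <= s] by [].
apply: closed_comp; last exact: closed_le.
by move=> x _; exact: continuous_enorm.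
Qed.

Lemma measurable_halfspace n (b : 'rV[R]_n) (t : R) :
  measurable ([set x | t <= (b *m x) 0 0] : set (borel_cV R n)).
Proof.
apply: closed_measurable_cV.
have -> : [set x : 'cV[R]_n | t <= (b *m x) 0 0] =
  (fun x => (b *m x) 0 0) @^-1` [set y | t <= y] by [].
apply: closed_comp; last exact: closed_ge.
by move=> x _; exact: continuous_row.
Qed.

Context (Pr : probability Om R).

Lemma fine_prob_subset (A B : set Om) : measurable A -> measurable B ->
  A `<=` B -> fine (Pr A) <= fine (Pr B).
Proof.
move=> mA mB AB; apply: fine_le; rewrite ?fin_num_measure//.
by apply: le_measure; rewrite ?inE.
Qed.

Lemma fine_prob_subsetU (A B C : set Om) :
  measurable A -> measurable B -> measurable C ->
  A `<=` B `|` C -> fine (Pr A) <= fine (Pr B) + fine (Pr C).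
Proof.
move=> mA mB mC ABC; rewrite -fineD ?fin_num_measure//.
apply: fine_le; rewrite ?fin_numD ?fin_num_measure//.
apply: le_trans (measureU2 _ mB mC).
by apply: le_measure; rewrite ?inE//; exact: measurableU.
Qed.

Lemma fine_prob_setC (A : set Om) : measurable A ->
  fine (Pr (~` A)) = 1 - fine (Pr A).
Proof.
by move=> mA; rewrite probability_setC// fineB ?fin_num_measure.
Qed.

Lemma fine_prob_le1 (A : set Om) : measurable A -> fine (Pr A) <= 1.
Proof.
by move=> mA; rewrite -lee_fin fineK ?fin_num_measure// probability_le1.
Qed.

Lemma fine_prob_ge0 (A : set Om) : 0 <= fine (Pr A).
Proof. exact: fine_ge0. Qed.

End random_vectors.

(** * The estimate-then-optimize problem *)

Section eto_facts.
Context {R : realType} {p q d : nat} (S : eto_problem R p q d).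
Hypothesis setS : setup S.

(** An equality of functions on the whole space, also at parameters where the log-likelihood is not
    integrable, so that it can be rewritten under [hess]. *)
Lemma EmlossE : Emloss S = fun th => - Eloglik S th.
Proof.
apply/funext => th; rewrite /Emloss /Eloglik /EP expectation.unlock -fine_integralN.
congr (fine _); apply: eq_integral => z _; congr (_%:E).
by rewrite /patch /mloss; case: ifP => //; rewrite oppr0.
Qed.

Lemma continuous_v0w L1 th : lipschitz_hessian S L1 -> Theta S th ->
  {for th, continuous (v0w S)}.
Proof.
move=> [_ td _] /td[/nbhs_singleton dth _]; exact: differentiable_continuous.
Qed.

(** Comparison with the Hessian at [thKL]: the Lipschitz condition on the bounded [Theta] makes the
    supremum [L2] one of a bounded set. *)
Lemma bounded_hess L1 : lipschitz_hessian S L1 -> forall th, Theta S th ->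
  opnorm (hess (v0w S) th) <= L2 S.
Proof.
move=> [bT _ lip] th Tth; have [C TC] := bounded_enorm bT.
have [_ _ _ _ [_ T0 _]] := setS.
apply: sup_upper_bound; last by exists th.
split; first by exists (opnorm (hess (v0w S) th)), th.
exists (`|L1| * (C + C) + opnorm (hess (v0w S) (thKL S))) => _ [u Tu <-].
rewrite -[hess (v0w S) u](subrK (hess (v0w S) (thKL S))).
apply: le_trans (opnormD _ _) _; rewrite lerD2r.
apply: le_trans (lip _ _ Tu T0) _; apply: le_trans (ler_norm _) _.
rewrite normrM ler_wpM2l// ger0_norm ?enorm_ge0//.
by apply: le_trans (enormD _ _) _; rewrite enormN; apply: lerD; exact: TC.
Qed.

Lemma L2_ge0 L1 : lipschitz_hessian S L1 -> 0 <= L2 S.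
Proof.
have [_ _ _ _ [_ T0 _]] := setS.
by move=> /bounded_hess/(_ _ T0); apply: le_trans; exact: opnorm_ge0.
Qed.

(** Continuity of [v0w] is known on [Theta] only. With a strict inequality the set is open, and
    since the estimator stays in [Theta] the event of interest is the preimage of the complement. *)
Lemma measurable_excess n (t : R) L1 : lipschitz_hessian S L1 ->
  measurable ([set th | Theta S th /\ Num.sqrt n%:R * (v0w S th - v0w S (thKL S)) < t]
    : set (borel_cV R q)).
Proof.
move=> lh; apply: open_measurable_cV; rewrite openE => th [Tth lt_t].
have [[_ oT _ _] _ _ _ _] := setS.
apply: filterI; first exact: open_nbhs_nbhs.
have c : (fun x => Num.sqrt n%:R * (v0w S x - v0w S (thKL S))) @ th -->
    Num.sqrt n%:R * (v0w S th - v0w S (thKL S)).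
  exact: cvgM (cvg_cst _) (cvgB (continuous_v0w lh Tth) (cvg_cst _)).
exact: (cvgr_lt _ c).
Qed.

Lemma taylor_v0w L1 (r : R) th : lipschitz_hessian S L1 ->
  (forall th, enorm (th - thKL S) < r -> Theta S th) ->
  enorm (th - thKL S) < r ->
  `|v0w S th - v0w S (thKL S) - (grad (v0w S) (thKL S) *m (th - thKL S)) 0 0| <=
    L2 S * enorm (th - thKL S) ^+ 2.
Proof.
move=> lh Tr thr; set u := th - _ in thr *.
have segT (t : R) : 0 <= t <= 1 -> Theta S (thKL S + t *: u).
  move=> /andP[t0 t1]; apply: Tr; rewrite addrC addKr enormZ ger0_norm//.
  by apply: le_lt_trans thr; rewrite ler_piMl ?enorm_ge0.
have -> : th = thKL S + u by rewrite /u subrKC.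
apply: taylor1_le => t t01; last exact: bounded_hess lh _ (segT _ t01).
by case: lh => _ td _; exact: td (segT _ t01).
Qed.

Section regularity.
Variables (mu c1 c2 c3 c4 lam1 lam2 r : R) (K1 K2 K3 : 'cV[R]_d -> R).
Hypotheses (mu0 : 0 < mu) (c40 : 0 < c4) (r0 : 0 < r).
Hypothesis ballT : forall th, enorm (th - thKL S) < r -> Theta S th.
Hypothesis reg : eto_regularity S mu c1 c2 c3 c4 lam1 lam2 K1 K2 K3.

Let Z : set (borel_cV R d) := Zset S.
Let score i (z : borel_cV R d) : R := grad (loglik S ^~ z) (thKL S) 0 i.

Let mZ : measurable Z. Proof. by case: setS => -[]. Qed.

Let loglik_derivable z u : Zset S z -> derivable (loglik S ^~ z) (thKL S) u.
Proof.
move=> Zz; have [[td _] _ _ _ _] := reg.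
have T0 : Theta S (thKL S) by case: setS => _ _ _ _ [].
have [/nbhs_singleton dm _] := td _ _ T0 Zz.
have -> : loglik S ^~ z = - (mloss S ^~ z).
  by apply/funext => th; rewrite fctE opprK.
exact/derivableN/diff_derivable.
Qed.

(** On [Z] the score is a pointwise limit of difference quotients, each measurable because the
    log-likelihood is integrable at every parameter of [Theta]. *)
Lemma measurable_score i : measurable_fun Z (score i).
Proof.
pose e : 'cV[R]_q := delta_mx i 0.
(* The factor r / 2 keeps all shifted parameters in the ball contained in [Theta]. *)
pose h (n : nat) : R := r / 2 * harmonic n.
have h0 n : 0 < h n by rewrite !mulr_gt0// invr_gt0// ltr0n.
have e1 : enorm e = 1.
  rewrite /enorm (bigD1 i)//= big1 => [|j ji].
    by rewrite mxE !eqxx expr1n addr0 sqrtr1.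
  by rewrite mxE (negbTE ji) expr0n.
have hr n : Theta S (h n *: e + thKL S).
  apply: ballT; rewrite addrK enormZ e1 mulr1 gtr0_norm//.
  apply: (@le_lt_trans _ _ (r / 2)); last by rewrite ltr_pdivrMr// ltr_pMr// ltr1n.
  have h1 : (n.+1%:R^-1 : R) <= 1 by rewrite invf_le1 ?ler1n ?ltr0n.
  by apply: ler_piMr => //; rewrite divr_ge0// ltW.
have ml th : Theta S th -> measurable_fun Z (loglik S th : borel_cV R d -> R).
  move=> Tth; have [_ _ _ _ [il _ _]] := setS.
  by have /measurable_int/measurable_EFinP := il _ Tth.
apply: (@measurable_fun_cvg _ (borel_cV R d) R Z
  (fun n (z : borel_cV R d) => (h n)^-1 * (loglik S (h n *: e + thKL S) z - loglik S (thKL S) z))).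
  move=> n; apply: measurable_funM => //.
  have T0 : Theta S (thKL S) by case: setS => _ _ _ _ [].
  by apply: measurable_funB; exact: ml.
move=> z Zz; rewrite /score mxE.
have hcvg : h @ \oo --> (0 : R)^'.
  have h00 : h @ \oo --> (0 : R).
    rewrite -(mulr0 (r / 2)); apply: cvgM; [exact: cvg_cst|exact: cvg_harmonic].
  by move=> A /h00[N _ hN]; exists N => // n /hN; apply; exact: lt0r_neq0.
pose G (k : R) := k^-1 *: ((loglik S ^~ z \o shift (thKL S)) (k *: e) -
  loglik S (thKL S) z).
have L : G @ (0 : R)^' --> 'D_e (loglik S ^~ z) (thKL S).
  exact: (loglik_derivable (u := e) Zz).
exact: (cvg_comp h G hcvg L).
Qed.

(** Each coordinate of the score is dominated by its Euclidean norm [e], whose fourth moment is at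
    most (c4 sqrt q)^4; [norm_covariance_le] applies with s = c4 sqrt q. *)
Lemma asymptotic_cov_entry_le i j :
  `|varP (trueP S) (Zset S) (fun z => grad (loglik S ^~ z) (thKL S)) i j| <=
    4 * (c4 * Num.sqrt q%:R) ^+ 2.
Proof.
have q0 : (0 < q)%N by case: (i) => m /(leq_ltn_trans (leq0n m)).
have s0 : 0 < c4 * Num.sqrt q%:R by rewrite mulr_gt0// sqrtr_gt0 ltr0n.
pose e : borel_cV R d -> R :=
  (fun z => enorm (grad (mloss S ^~ z) (thKL S))^T) \_ (Zset S).
pose X k : borel_cV R d -> R := score k \_ Z.
have mX k : measurable_fun setT (X k).
  exact: (measurable_restrictT (score k) mZ).1 (measurable_score k).
have gradE z : grad (mloss S ^~ z) (thKL S) = - grad (loglik S ^~ z) (thKL S).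
  exact: gradN.
have eE z : e z = Num.sqrt (\sum_k (X k z) ^+ 2).
  rewrite /e /X /patch; case: ifP => _.
    rewrite /enorm; congr Num.sqrt; apply: eq_bigr => k _.
    by rewrite gradE !mxE sqrrN /score mxE.
  by rewrite big1 ?sqrtr0// => k _; rewrite expr0n.
have me : measurable_fun setT e.
  rewrite (_ : e = Num.sqrt \o (fun z => \sum_k (X k z) ^+ 2)).
    apply: measurableT_comp.
      by apply: continuous_measurable_fun; exact: sqrt_continuous.
    by apply: measurable_sum => k; exact: measurable_funX.
  by apply/funext => z /=; rewrite eE.
have Xe k z : `|X k z| <= e z.
  rewrite eE -(@ler_pXn2r _ 2) ?nnegrE ?sqrtr_ge0// sqr_sqrtr; last first.
    by rewrite sumr_ge0// => j' _; exact: sqr_ge0.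
  rewrite real_normK ?num_real// (bigD1 k)//= lerDl sumr_ge0// => j' _.
  exact: sqr_ge0.
rewrite /varP mxE; apply: (norm_covariance_le s0 (mX i) (mX j) me (Xe i) (Xe j)).
apply: Lnorm4_le; first exact: ltW.
by case: reg.
Qed.

(** Coercivity of the Hessian of the expected loss comes from the quadratic growth on the ball, its
    symmetry from the eigenvalue condition. *)
Lemma opnorm_sqrt_cov_le M1 : psd_sqrt (asymptotic_cov S) M1 ->
  opnorm M1 ^+ 2 <= 4 * c4 ^+ 2 / mu ^+ 2 * q%:R ^+ 2.
Proof.
move=> [[M1T _] M12].
have [[_ tdE] _ [growth _ _ _] [_ [HT _]] _] := reg.
have coer x : mu * enorm x ^+ 2 <= (x^T *m hess (Emloss S) (thKL S) *m x) 0 0.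
  apply: quadratic_growth_hess r0 tdE _ (ltW mu0) => y yr.
  exact/growth/ballT.
have hE : hess (Eloglik S) (thKL S) = - hess (Emloss S) (thKL S).
  by rewrite EmlossE hessN opprK.
have c0 : 0 <= 4 * (c4 * Num.sqrt q%:R) ^+ 2 by rewrite mulr_ge0 ?sqr_ge0.
have := opnorm_sandwich_le mu0 c0 HT coer asymptotic_cov_entry_le M1T.
rewrite -hE => /(_ M12) /le_trans; apply.
rewrite exprMn sqr_sqrtr ?ler0n// le_eqVlt; apply/orP; left; apply/eqP; field.
by rewrite gt_eqF.
Qed.

End regularity.

End eto_facts.

(** * Linear images of the Gaussian vector *)

Section image_of_gaussian.
Context {R : realType} (q : nat) d {Om : measurableType d} (Pr : probability Om R).
Variables (Y : Om -> 'cV[R]_q) (M : 'M[R]_q).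
Hypothesis gY : std_gaussian Pr Y.

Lemma measurable_mulmx_ball (s : R) : 0 <= s ->
  measurable [set om | enorm (M *m Y om) <= s].
Proof.
move=> s0; pose f om : measurableTypeR R := \sum_i ((row i M *m Y om) 0 0) ^+ 2.
have mf : measurable_fun setT f.
  by apply: measurable_sum => i; apply: measurable_funX; exact: measurable_row gY _.
have fE om : enorm (M *m Y om) = Num.sqrt (f om).
  by rewrite /enorm; congr Num.sqrt; apply: eq_bigr => i _; rewrite -row_mul [in RHS]mxE.
rewrite (_ : [set om | _] = f @^-1` `]-oo, s ^+ 2]).
  by rewrite -[X in measurable X]setTI; exact: mf.
apply/seteqP; split=> om /=; rewrite in_itv/= fE.
  move=> fs; rewrite -[f om]sqr_sqrtr; last first.
    by rewrite sumr_ge0// => i _; exact: sqr_ge0.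
  by rewrite lerXn2r ?nnegrE ?sqrtr_ge0.
by move=> /ler_wsqrtr; rewrite sqrtr_sqr ger0_norm.
Qed.

Lemma measurable_mulmx_halfspace (b : 'rV[R]_q) (t : R) :
  measurable [set om | t <= (b *m (M *m Y om)) 0 0].
Proof.
rewrite (_ : [set om | _] =
    (fun om => ((b *m M) *m Y om) 0 0 : measurableTypeR R) @^-1` `[t, +oo[).
  by rewrite -[X in measurable X]setTI; apply: (measurable_row gY (b *m M)).
by apply/seteqP; split=> om /=; rewrite in_itv/= andbT mulmxA.
Qed.

Lemma gaussian_norm_tail (n : nat) : (0 < n)%N ->
  1 - fine (Pr [set om | enorm (M *m Y om) <=
      opnorm M * Num.sqrt (q%:R * ln n%:R)]) <=
  2 * (q%:R / Num.sqrt n%:R).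
Proof.
move=> n0; have N0 : 0 < n%:R :> R by rewrite ltr0n.
have l0 : 0 <= ln (n%:R : R) by rewrite ln_ge0// ler1n.
set s := opnorm M * _.
have s0 : 0 <= s by rewrite mulr_ge0 ?opnorm_ge0 ?sqrtr_ge0.
have mB := measurable_mulmx_ball s0.
rewrite -fine_prob_setC// -lee_fin fineK ?fin_num_measure//; last exact: measurableC.
apply: le_trans (le_trans (gaussian_coord_tail gY (sqrtr_ge0 (ln n%:R))) _).
  apply: le_measure; rewrite ?inE//; first exact: measurableC.
    exact: (measurable_coord_tail gY).
  move=> om /= /negP; rewrite -ltNge => sM; apply: contrapT => nex.
  have Yl i : `|Y om i 0| <= Num.sqrt (ln n%:R).
    by rewrite leNgt; apply/negP => lt_i; apply: nex; exists i.
  move: sM; apply/negP; rewrite -leNgt; apply: le_trans (enorm_mulmx _ _) _.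
  rewrite /s ler_wpM2l ?opnorm_ge0// sqrtrM ?ler0n//.
  by apply: enorm_le_coord => //; exact: sqrtr_ge0.
rewrite lee_fin sqr_sqrtr// mulrCA; apply: ler_wpM2l => //; apply: ler_wpM2l => //.
rewrite le_eqVlt; apply/orP; left; apply/eqP.
(* At the level sqrt (ln n) the tail exp(- ln n / 2) is exactly 1 / sqrt n. *)
rewrite -powR12_sqrt ?(ltW N0)// /powR gt_eqF// -expRN; congr expR.
by rewrite mulrC.
Qed.

End image_of_gaussian.

(* The hidden constant K is chosen before the dimensions p, q, d, the sample
   size n and the problem: it depends only on the constants of the regularity
   conditions, on C^ETO, and on the radius r of a ball around thKL inside the
   (not necessarily convex) open set Theta. *)
Theorem proposition1 (R : realType)
  (mu c1 c2 c3 c4 lam1 lam2 CETO r : R)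
  (mu_gt0 : 0 < mu) (c1_gt0 : 0 < c1) (c2_gt0 : 0 < c2) (c3_ge0 : 0 <= c3)
  (c4_gt0 : 0 < c4) (lam1_gt0 : 0 < lam1) (lam2_gt0 : 0 < lam2)
  (r_gt0 : 0 < r) :
  exists K : R, 0 < K /\
  forall (p q d : nat) (S : eto_problem R p q d) (L1 : R)
    (K1 K2 K3 : 'cV[R]_d -> R) (M1 : 'M[R]_q)
    (dO : measure_display) (Om : measurableType dO) (Pr : probability Om R)
    (z : nat -> Om -> 'cV[R]_d) (thhat : nat -> Om -> 'cV[R]_q)
    (dY : measure_display) (OmY : measurableType dY) (PrY : probability OmY R)
    (Y0 : OmY -> 'cV[R]_q)
    (dN : measure_display) (OmN : measurableType dN) (PrN : probability OmN R)
    (N1 : OmN -> 'cV[R]_q),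
    setup S ->
    (forall th : 'cV[R]_q, enorm (th - thKL S) < r -> Theta S th) ->
    iid_sample S Pr z ->
    eto_estimator S z thhat ->
    std_gaussian PrY Y0 ->
    psd_sqrt (asymptotic_cov S) M1 ->
    random_vector N1 ->
    equal_in_law PrN PrY N1 (fun om => M1 *m Y0 om) ->
    lipschitz_hessian S L1 ->
    eto_consistency S Pr z ->
    eto_regularity S mu c1 c2 c3 c4 lam1 lam2 K1 K2 K3 ->
    berry_esseen CETO
      Pr (fun n om => Num.sqrt n%:R *: (thhat n om - thKL S))
      PrY (fun om => M1 *m Y0 om) ->
    let g := grad (v0w S) (thKL S) in
    enorm (g *m M1)^T != 0 ->
    exists G : nat -> R,
      (forall n : nat, (0 < n)%N ->
        G n <= K * (opnorm M1 ^+ 2 * L2 S / enorm (g *m M1)^T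
                      * q%:R / Num.sqrt n%:R * ln n%:R
                    + be_term q CETO n)) /\
      (forall (n : nat) (t : R), (0 < n)%N ->
        `|fine (Pr [set om | t <=
              Num.sqrt n%:R * (v0 S (wopt S (thhat n om)) - v0 S (wopt S (thKL S)))])
          - fine (PrN [set om | t <= (g *m N1 om) 0 0])| <= G n).
Proof.
pose b := 4 * c4 ^+ 2 / mu ^+ 2.
have b0 : 0 < b by rewrite divr_gt0 ?mulr_gt0 ?exprn_gt0.
pose kap := (r ^+ 2 / (3 * b)) `^ (3 / 4).
have kap0 : 0 < kap.
  by apply: powR_gt0; apply: divr_gt0; [exact: exprn_gt0|exact: mulr_gt0].
(* The 2 counts the two uses of Berry-Esseen and the factor of anti-concentration, 2 / CETO absorbs
   the tail 2 q / sqrt n, and 1 / (CETO kap) makes the bound exceed 1 when s >= r sqrt n. The value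
   1 is a placeholder for a contradictory case. *)
pose K : R := if 0 < CETO then 2 + 2 / CETO + 1 / (CETO * kap) else 1.
exists K; split.
  rewrite /K; case: ifP => // C0.
  by rewrite addr_gt0 ?addr_gt0 ?divr_gt0 ?mulr_gt0.
move=> p q d S L1 K1 K2 K3 M1 dO Om Pr z thhat dY OmY PrY Y0 dN OmN PrN N1.
move=> setS ballT _ est gY sqM1 _ lawN lh _ reg BE g gN0.
exists (fun n => K * (opnorm M1 ^+ 2 * L2 S / enorm (g *m M1)^T
  * q%:R / Num.sqrt n%:R * ln n%:R + be_term q CETO n)); split => // n t n0.
have sg0 : 0 < enorm (g *m M1)^T by rewrite lt_neqAle eq_sym gN0 enorm_ge0.
have q0 : (0 < q)%N.
  rewrite lt0n; apply: contra_neq gN0 => q0.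
  by rewrite /enorm big1 ?sqrtr0// => i _; have := leq_trans (ltn_ord i) (eq_leq q0).
pose D k om := Num.sqrt k%:R *: (thhat k om - thKL S).
have rvD k : (0 < k)%N -> random_vector (D k).
  by move=> k0; apply: random_vector_affine; case: (est k k0).
have [C0|C0] := leP CETO 0.
  (* The estimator is bounded and the Gaussian is not, so CETO must be positive. *)
  exfalso; have [bT _ _] := lh; have [C TC] := bounded_enorm bT.
  have T0 : Theta S (thKL S) by case: setS => _ _ _ _ [].
  have CC0 : 0 <= C + C.
    by rewrite addr_ge0// (le_trans (enorm_ge0 (thKL S)))// TC.
  (* At n = 1 the scaling is trivial, so [D 1] always lies in the ball of radius C + C; a
     nonpositive error would give this ball Gaussian probability 1. *)
  have := BE 1%N _ isT (measurable_enorm_ball (C + C)) (@convex_enorm_ball _ _ _).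
  rewrite -/(D 1%N) [X in Pr X](_ : _ = setT); last first.
    apply/seteqP; split => // om _; rewrite /D/= sqrtr1 scale1r.
    apply: le_trans (enormD _ _) _; rewrite enormN.
    by apply: lerD; apply: TC => //; have [_ /(_ om)[]] := est 1%N isT.
  have bt0 : be_term q CETO 1 <= 0.
    by rewrite /be_term sqrtr1 divr1 mulr_le0_ge0// powR_ge0.
  move=> /le_trans/(_ bt0); rewrite normr_le0 probability_setT subr_eq0 eq_sym.
  have mB := measurable_mulmx_ball M1 gY CC0.
  move=> /eqP PB; apply: (gaussian_unbounded gY (b := g *m M1)
    (B := enorm g^T * (C + C)) sg0).
  set A := [set om | _].
  have mA : measurable A.
    rewrite (_ : A = (fun om => ((g *m M1) *m Y0 om) 0 0 : measurableTypeR R)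
        @^-1` `[- (enorm g^T * (C + C)), enorm g^T * (C + C)]).
      by rewrite -[X in measurable X]setTI; exact: measurable_row gY _ _ _ _.
    by apply/seteqP; split=> om; rewrite /A/= in_itv/= ler_norml.
  rewrite -[LHS]fineK ?fin_num_measure//; congr (_%:E); apply/eqP.
  rewrite eq_le fine_prob_le1//= -[leLHS]PB fine_prob_subset// => om /= BY.
  rewrite /A/= -mulmxA -[g in g *m _]trmxK; apply: le_trans (cauchy_schwarz_mx _ _) _.
  by rewrite ler_wpM2l ?enorm_ge0.
have N0 : 0 < n%:R :> R by rewrite ltr0n.
set N := n%:R : R in N0 *; have sN0 : 0 < Num.sqrt N by rewrite sqrtr_gt0.
have lN0 : 0 <= ln N by rewrite ln_ge0// ler1n.
have L20 : 0 <= L2 S := L2_ge0 setS lh.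
set sg := enorm (g *m M1)^T in sg0 *.
set T1 := opnorm M1 ^+ 2 * L2 S / sg * q%:R / Num.sqrt N * ln N.
have T10 : 0 <= T1.
  apply: mulr_ge0 => //; apply: divr_ge0; last exact: sqrtr_ge0.
  apply: mulr_ge0 => //; apply: divr_ge0; last exact: ltW.
  exact: mulr_ge0 (sqr_ge0 _) L20.
set be := be_term q CETO n.
have qbe : q%:R / Num.sqrt N <= be / CETO.
  by rewrite ler_pdivlMr// mulrC; apply: be_term_ge => //; exact: ltW.
have be0 : 0 <= be.
  apply: divr_ge0; last exact: sqrtr_ge0.
  exact: mulr_ge0 (ltW C0) (powR_ge0 _ _).
have iC : 0 <= 2 / CETO by rewrite divr_ge0// ltW.
have ik : 0 <= 1 / (CETO * kap) by rewrite divr_ge0// mulr_ge0// ltW.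
rewrite /K C0; set U := [set om | _].
have [rvt thT] := est n n0.
have mU : measurable U.
  rewrite (_ : U = thhat n @^-1` (~` [set th | Theta S th /\
      Num.sqrt n%:R * (v0w S th - v0w S (thKL S)) < t])).
    by apply: measurable_preimage => //; apply: measurableC; exact: measurable_excess lh.
  apply/seteqP; split=> om; rewrite /U/=.
    by move=> tU [_]; rewrite ltNge tU.
  by move=> nU; rewrite leNgt; apply/negP => lt_t; apply: nU; split => //; case: (thT om).
pose s := opnorm M1 * Num.sqrt (q%:R * ln N).
have s0 : 0 <= s by rewrite mulr_ge0 ?opnorm_ge0 ?sqrtr_ge0.
pose wH a := fine (PrY [set om | a <= (g *m (M1 *m Y0 om)) 0 0]).
have mwH a := measurable_mulmx_halfspace M1 gY g a.
have -> : fine (PrN [set om | t <= (g *m N1 om) 0 0]) = wH t.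
  by congr fine; exact: lawN (measurable_halfspace g t).
(* On the ball of radius [s / sqrt n] Taylor's formula needs [Theta] to contain
   the segment to thKL, hence the split on [s < r * sqrt n]. *)
have [sr|rs] := ltP s (r * Num.sqrt N); last first.
  have M1b : opnorm M1 ^+ 2 <= b * q%:R ^+ 2.
    exact: (opnorm_sqrt_cov_le setS mu_gt0 c4_gt0 r_gt0 ballT reg sqM1).
  have := be_term_lower_bound (ltW C0) r_gt0 b0 n0 M1b rs.
  rewrite -/kap -/be => kbe.
  have d1 : `|fine (Pr U) - wH t| <= 1.
    have := fine_prob_le1 Pr mU; have := fine_prob_ge0 Pr U.
    have := fine_prob_le1 PrY (mwH t).
    have := fine_prob_ge0 PrY [set om | t <= (g *m (M1 *m Y0 om)) 0 0].
    by rewrite ler_norml -/(wH t) => *; lra.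
  apply: le_trans d1 _.
  have k1 : 1 <= 1 / (CETO * kap) * be.
    by rewrite mulrC mulrA mulr1 ler_pdivlMr ?mul1r ?mulr_gt0.
  have := mulr_ge0 iC be0.
  have := mulr_ge0 ik T10.
  have := mulr_ge0 iC T10.
  by rewrite mulrDr !mulrDl; lra.
pose de := L2 S * s ^+ 2 / Num.sqrt N.
have de0 : 0 <= de := divr_ge0 (mulr_ge0 L20 (sqr_ge0 _)) (sqrtr_ge0 _).
have deT1 : de / sg = T1.
  rewrite /de /T1 /s exprMn sqr_sqrtr ?mulr_ge0 ?ler0n//; field.
  by rewrite !gt_eqF.
pose Bad := ~` (D n @^-1` [set x | enorm x <= s]).
pose H a := D n @^-1` [set x | a <= (g *m x) 0 0].
have mH a : measurable (H a).
  by apply: measurable_preimage (rvD _ n0) _; exact: measurable_halfspace.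
have mB : measurable (D n @^-1` [set x | enorm x <= s]).
  by apply: measurable_preimage (rvD _ n0) _; exact: measurable_enorm_ball.
have mBad : measurable Bad by exact: measurableC.
have close om : ~ Bad om ->
    `|Num.sqrt N * (v0w S (thhat n om) - v0w S (thKL S)) - (g *m D n om) 0 0| <= de.
  move=> /contrapT /=; rewrite /D; set u := thhat n om - thKL S.
  rewrite enormZ gtr0_norm// => us.
  have ur : enorm u < r.
    by rewrite -(ltr_pM2r sN0); apply: le_lt_trans sr; rewrite mulrC.
  have -> : (g *m (Num.sqrt N *: u)) 0 0 = Num.sqrt N * (g *m u) 0 0.
    by rewrite -scalemxAr mxE.
  rewrite -mulrBr normrM (gtr0_norm sN0).
  apply: le_trans (ler_wpM2l (ltW sN0) (taylor_v0w setS lh ballT ur)) _.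
  rewrite /de ler_pdivlMr// mulrAC -expr2 -/u mulrCA ler_wpM2l// -exprMn.
  by rewrite lerXn2r ?nnegrE// mulr_ge0 ?enorm_ge0 ?sqrtr_ge0.
(* Outside [Bad], the event [U] lies between the half-space events [H (t + de)] and [H (t - de)]. *)
have le1 : fine (Pr U) <= fine (Pr (H (t - de))) + fine (Pr Bad).
  apply: fine_prob_subsetU => // om Uom.
  have [?|/close] := pselect (Bad om); first by right.
  rewrite ler_norml => /andP[_ h]; left; rewrite /H/=.
  have : t <= Num.sqrt N * (v0w S (thhat n om) - v0w S (thKL S)) := Uom.
  lra.
have le2 : fine (Pr (H (t + de))) <= fine (Pr U) + fine (Pr Bad).
  apply: fine_prob_subsetU => // om Hom.
  have [?|/close] := pselect (Bad om); first by right.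
  rewrite ler_norml => /andP[h _]; left.
  suff : t <= Num.sqrt N * (v0w S (thhat n om) - v0w S (thKL S)) by [].
  by move: Hom; rewrite /H/= => Hom; lra.
(* Berry-Esseen on the ball transfers the Gaussian tail to the estimator, at the cost of one more
   error term. *)
have leBad : fine (Pr Bad) <= 2 * (q%:R / Num.sqrt N) + be.
  rewrite fine_prob_setC//.
  have := gaussian_norm_tail M1 gY n0.
  have := BE n _ n0 (measurable_enorm_ball s) (@convex_enorm_ball _ _ _).
  by rewrite ler_norml -/(D n) -/be => /andP[h1 _] h2; lra.
have BEH a : `|fine (Pr (H a)) - wH a| <= be.
  exact: BE n _ n0 (measurable_halfspace g a) (@convex_halfspace _ _ _ _).
have anti a : wH (a - de) <= wH a + 2 * T1.
  have mW : measurable [set om | a - de <= ((g *m M1) *m Y0 om) 0 0 < a].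
    rewrite (_ : [set om | _] = (fun om => ((g *m M1) *m Y0 om) 0 0 :
        measurableTypeR R) @^-1` `[a - de, a[).
      by rewrite -[X in measurable X]setTI; exact: measurable_row gY _ _ _ _.
    by apply/seteqP; split=> om; rewrite /= in_itv.
  have := gaussian_anticoncentration gY (b := g *m M1) a de0 sg0.
  rewrite -/sg deT1 -[X in (X <= _)%E]fineK ?fin_num_measure// lee_fin => ac.
  apply: (@le_trans _ _ (wH a + fine (PrY [set om | a - de <= ((g *m M1) *m Y0 om) 0 0 < a]))).
    apply: fine_prob_subsetU => // om /= ad.
    by case: (leP a ((g *m (M1 *m Y0 om)) 0 0)) => ha; [left|right; rewrite -mulmxA ad].
  by rewrite lerD2l.
(* The interval in [anti] lies below its argument: at t it serves the upper bound, at t + de the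
   lower one. *)
have a1 := anti t; have a2 := anti (t + de); rewrite addrK in a2.
have /andP[_ b1] : - be <= fine (Pr (H (t - de))) - wH (t - de) <= be by rewrite -ler_norml.
have /andP[b2 _] : - be <= fine (Pr (H (t + de))) - wH (t + de) <= be by rewrite -ler_norml.
(* One error term comes from the half-space, one from the ball; the last summand is the Gaussian
   tail. *)
have dn : `|fine (Pr U) - wH t| <= 2 * T1 + 2 * be + 2 * (q%:R / Num.sqrt N).
  by rewrite ler_norml; apply/andP; split; lra.
apply: le_trans dn _.
have c1' : 2 * (q%:R / Num.sqrt N) <= 2 / CETO * be
  by rewrite -mulrA ler_pM2l// [_^-1 * _]mulrC.
have := mulr_ge0 ik T10; have := mulr_ge0 ik be0; have := mulr_ge0 iC T10.
by rewrite mulrDr !mulrDl; lra.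
Qed.
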